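(* Let $(X_t)_{t\in\mathbb{Z}_+}$ be a stationary Markov process with invariant measure $\Pi$ and transition kernels $(\mathcal{P}_t)_{t\in\mathbb{Z}_+}$. Assume there are a function $M:\mathbf{X}\to[1,\infty)$ and a function $R:[0,\infty)\to(0,1]$ strictly monotonically decreasing to $0$ such that $\|\mathcal{P}_t(x,\cdot)-\Pi\|_{BL(d)}\le M(x)R(t)$ for every $x\in\mathbf{X}$ and $t\in\mathbb{Z}_+$. Let $p>1$ and define $r_{p,\infty}(m)=\int_m^\infty R(u)^{\frac12(1-1/p)}\,du$ for $m\in\mathbb{Z}_+$. Then there is a constant $c_1\le 24$ such that for all Lipschitz functions $f:\mathbf{X}\to\mathbb{R}$ with $\int_{\mathbf{X}}f\,d\Pi=0$ the following hold. (1) If $t,n\in\mathbb{Z}_+$ satisfy $n-1\ge t\ge R^{-1}\big[SFR_{2p}(f)^{2p}\big]$, then $$\mathbb{E}\left(\Big|\frac1n\sum_{s=0}^{n-1}f(X_s)\Big|^2\right)\le\|f\|_{L_{2p}(\Pi)}^2\,\frac2n\left\{t+2\sqrt6\Big[\int_{\mathbf{X}}M\,d\Pi\Big]^{\frac12\left(1-\frac{1}{2p}\right)}\Big(R(t)^{\frac12\left(1-\frac1p\right)}+r_{p,\infty}(t)\Big)\right\}.$$ (2) For every integer $n\ge1$, $$\mathbb{E}\left(\Big|\frac1n\sum_{s=0}^{n-1}f(X_s)\Big|^2\right)\le\frac1n\|f\|_{\mathrm{Lip}(d)}^2K_\Pi\left[1+2C_{2,\Pi}^{1/2}\Big(\int_{\mathbf{X}}M\,d\Pi\Big)^{\frac12\left(1-\frac{1}{2p}\right)}r_{p,\infty}(0)\right],$$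 where $K_\Pi=\|d\|_{L_2(\Pi\otimes\Pi)}\vee\|d\|_{L_2(\Pi\otimes\Pi)}^2$ and $C_{2,\Pi}=2^{-1}c_1\big[\tfrac12+\tfrac32\|d\|_{L_{2p}(\Pi\otimes\Pi)}^2\big]$.
   Context: $\mathbf{X}$ is a nonempty metric space with metric $d$; all sets, functions and measures are Borel. $\mathbb{Z}_+=\{0,1,2,\dots\}$. $\mathcal{P}_t(x,\cdot)=\mathbb{P}(X_t\in\cdot\mid X_0=x)$ are the transition kernels of the (time-homogeneous) Markov process, forming a Markov semigroup on $L_2(\Pi)$; $\Pi$ is the unique invariant probability measure, and stationary means $X_0\sim\Pi$. Write $\mathcal{P}_tf(x)=\int f(y)\,\mathcal{P}_t(x,dy)$. $\|f\|_\infty=\sup_x|f(x)|$, $\|f\|_{\mathrm{Lip}(d)}=\sup_{x\ne y}|f(y)-f(x)|/d(x,y)$, and $$\|\mathcal{P}_t(x,\cdot)-\Pi\|_{BL(d)}=\sup\Big\{\Big|\mathcal{P}_tf(x)-\int f\,d\Pi\Big|:\|f\|_{\mathrm{Lip}(d)}+\|f\|_\infty\le1\Big\}.$$ The spread to fluctuation ratio of order $p\ge1$ is $SFR_p(f)=\|f-\int f\,d\Pi\|_{L_p(\Pi)}/\|f\|_{\mathrm{Lip}(d)}$ (for constant $f$ read it as $+\infty$). The condition $t\ge R^{-1}[u]$ means $R(t)\le u$. $\|d\|_{L_s(\Pi\otimes\Pi)}^s=\int\int d(x,y)^s\,\Pi(dx)\Pi(dy)$; $\vee$ denotes maximum. Inequalities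 whose right-hand side is $+\infty$ are regarded as trivially true. *)

(* Defs.v *)
From HB Require Import structures.
From mathcomp Require Import all_boot all_order all_algebra.
From mathcomp Require Import all_classical all_reals all_analysis.
Set Implicit Arguments.
Unset Strict Implicit.
Unset Printing Implicit Defensive.
Import Order.TTheory GRing.Theory Num.Theory.
Import numFieldNormedType.Exports.

Local Open Scope classical_set_scope.
Local Open Scope ring_scope.

(* A nonempty metric space; measurable types are pointed, hence the base point. *)
#[short(type="pointedMetricType")]
HB.structure Definition PointedMetric (K : numDomainType) :=
  {M of Metric K M & isPointed M}.

Notation borel X := (g_sigma_algebraType (@open X)).

Section Norms.
Local Open Scope ereal_scope.
Context {R : realType} {X : pointedMetricType R}.
Implicit Types (f : X -> R) (Pi : probability (borel X) R).

Definition sup_norm f : \bar R := ereal_sup [set `|f x|%:E | x in [set: X]].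

(* The maximum with 0 only matters when X is a singleton: it makes the
   supremum over the empty set 0 instead of -oo. *)
Definition lip_norm f : \bar R :=
  maxe 0 (ereal_sup [set (`|f z.2 - f z.1| / mdist z.1 z.2)%:E
                    | z in [set z : X * X | z.1 != z.2]]).

Definition bl_dist (mu nu : {measure set (borel X) -> \bar R}) : \bar R :=
  ereal_sup [set `| \int[mu]_x (f x)%:E - \int[nu]_x (f x)%:E |
            | f in [set f : X -> R | lip_norm f + sup_norm f <= 1]].

Definition SFR Pi (p : R) f : \bar R :=
  if lip_norm f == 0 then +oo
  else 'N[Pi]_(p%:E)[(fun x => (f x)%:E - \int[Pi]_y (f y)%:E)] / lip_norm f.

(* An iterated integral: X is not assumed separable, so mdist need not be
   measurable for the product of the Borel sigma-algebras. *)
Definition dist_Lnorm Pi (s : R) : \bar R :=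
  (\int[Pi]_y \int[Pi]_x (mdist (x : X) (y : X) `^ s)%:E) `^ s^-1.

End Norms.

Section Markov.
Local Open Scope ereal_scope.
Context {R : realType} {d : measure_display} {T : measurableType d}.
Implicit Types (P : nat -> R.-pker T ~> T) (Pi : probability T R).

Definition markov_semigroup P : Prop :=
  (forall x A, measurable A -> P 0%N x A = \d_x A) /\
  (forall s t x A, measurable A ->
     P (s + t)%N x A = \int[P s x]_y P t y A).

Definition invariant P Pi : Prop :=
  forall t A, measurable A -> \int[Pi]_x P t x A = Pi A.

Definition unique_invariant P Pi : Prop :=
  invariant P Pi /\
  forall nu : probability T R, invariant P nu ->
    forall A, measurable A -> nu A = Pi A.

Context {d' : measure_display} {Omega : measurableType d'}.
Variable PP : probability Omega R.

(* The sigma-algebra generated by X_0, ..., X_s. *)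
Definition history (X : nat -> {RV PP >-> T}) (s : nat) : set (set Omega) :=
  <<s \bigcup_(i in [set i | (i <= s)%N])
        preimage_set_system setT (X i) measurable >>.

(* P(X_{s+t} in A | X_0, ..., X_s) = P_t(X_s, A) almost surely, the conditional
   probability being characterized by its integrals over the past events. *)
Definition markov_property P (X : nat -> {RV PP >-> T}) : Prop :=
  forall s t E A, history X s E -> measurable A ->
    PP (E `&` X (s + t)%N @^-1` A) = \int[PP]_(w in E) P t (X s w) A.

Definition stationary_markov_process P Pi (X : nat -> {RV PP >-> T}) : Prop :=
  [/\ markov_semigroup P, unique_invariant P Pi, markov_property P X &
      forall A, measurable A -> distribution PP (X 0%N) A = Pi A].

End Markov.

Section Rate.
Context {R : realType}.

(* Only the values of rate on [0, +oo[ matter. *)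
Definition rate_function (rate : R -> R) : Prop :=
  [/\ forall u, 0 <= u -> 0 < rate u <= 1,
      forall u v, 0 <= u -> u < v -> rate v < rate u &
      rate u @[u --> +oo] --> (0 : R)].

Definition rate_tail (rate : R -> R) (p : R) (m : nat) : \bar R :=
  (\int[lebesgue_measure]_(u in `[m%:R, +oo[)
     (rate u `^ (2^-1 * (1 - p^-1)))%:E)%E.

End Rate.

(* Main.v *)
(* Stationarity reduces the claim to summing the covariances E f(X_s) f(X_{s+k}).
   Truncate the two factors at levels b <= a.  The bounded-Lipschitz distance
   controls the covariance of the truncations, at cost about a b R(k) ∫M, and
   the tails cost (a^(2-q) + b^(2-q)) ∫|f|^q, where q = 2p.  The choice
   a = A R(k)^(-1/q), b = A (R(k) ∫M)^(-1/q) balances the two and bounds the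
   covariance by a multiple of Z = (∫M)^(1-1/q) R(k)^(1-1/p).  The covariance
   is also at most ∫f^2, and the geometric mean of the two bounds has the rate
   Z^(1/2) of the statement.  Part (1) takes A = ||f||_q, part (2) takes
   A = ||f||_Lip max(1, ||d||_q); the truncated factor must be
   ||f||_Lip-Lipschitz with ||f||_Lip <= a, which is where the condition on
   SFR enters. *)
Require Import Defs.
From HB Require Import structures.
From mathcomp Require Import all_boot all_order all_algebra.
From mathcomp Require Import ring lra.
From mathcomp Require Import all_classical all_reals all_analysis.
From mathcomp Require Import measurable_realfun.
Set Implicit Arguments.
Unset Strict Implicit.
Unset Printing Implicit Defensive.
Import Order.TTheory GRing.Theory Num.Theory.
Import numFieldNormedType.Exports.
Local Open Scope classical_set_scope.
Local Open Scope ring_scope.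

(** * Truncation *)

(** The Markov property is given on events only and extends to products of nonnegative functions.
    The truncations are therefore shifted by their levels to become nonnegative, which gives the
    cost 2 b (l + 2 a) R(k) ∫M, at most 6 a b R(k) ∫M once l = ||f||_Lip <= a. The levels differ
    because only the later factor is integrated against the kernel and must be Lipschitz with l <=
    a. Keeping ∫M out of a turns this condition into R(k) <= (A / l)^q, as in the hypothesis on SFR;
    the earlier factor needs only a bound, so b can carry ∫M. Each tail is paid twice, so the
    covariance is at most (6 A^2 + 4 A^(2-q) ∫|f|^q) Z. For A = ||f||_q this is 10 A^2 Z, and sqrt
    10 <= 2 sqrt 6. In part (2) it is at most l^2 (6 + 10 ||d||_q^2) Z, and matching the constant
    term 6 with c_1 / 4 gives c_1 = 24. The bounds are first proved for real data. The passage to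
    extended reals has to respect 0 * +oo = 0, so vanishing factors are treated before infinite ones
    that they could multiply. *)

Section Truncation.
Context {R : realType}.
Implicit Types a b c q u v : R.

Definition clip c u : R := Num.max (- c) (Num.min c u).

Lemma clip_id c u : `|u| <= c -> clip c u = u.
Proof. by rewrite ler_norml => /andP[h1 h2]; rewrite /clip min_r// max_r. Qed.

Lemma normr_clip_le c u : 0 <= c -> `|clip c u| <= c.
Proof.
move=> c0; rewrite ler_norml /clip le_max lexx/= ge_max ge_min lexx/= andbT.
by lra.
Qed.

Lemma ler_dist_clip c u v : `|clip c u - clip c v| <= `|u - v|.
Proof.
rewrite /clip; case: (leP u v) => uv;
  [rewrite (ler0_norm (x := u - v)); last lra
  |rewrite (ger0_norm (x := u - v)); last lra];
  rewrite ler_norml;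
  case: (leP c u) => h1; case: (leP c v) => h2;
  repeat match goal with |- context [Order.max ?x ?y] => case: (leP x y) => ? end;
  lra.
Qed.

Lemma ler_dist_clip_norm c u : 0 <= c -> `|u - clip c u| <= `|u|.
Proof.
move=> c0; rewrite /clip; case: (leP 0 u) => u0;
  [rewrite (ger0_norm u0) | rewrite (ltr0_norm u0)];
  rewrite ler_norml;
  case: (leP c u) => h1;
  repeat match goal with |- context [Order.max ?x ?y] => case: (leP x y) => ? end;
  lra.
Qed.

Lemma powR_tail_le b x q r : 0 < b -> b <= x -> r <= q ->
  x `^ r <= b `^ (r - q) * x `^ q.
Proof.
move=> b0 bx rq; have x0 : 0 < x by apply: lt_le_trans bx.
have -> : x `^ r = x `^ (r - q) * x `^ q.
  by rewrite -powRD ?subrK// (gt_eqF x0) implybT.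
rewrite ler_wpM2r ?powR_ge0// -opprB !powRN lef_pV2 ?posrE ?powR_gt0//.
by apply: ge0_ler_powR; rewrite ?nnegrE ?subr_ge0// ltW.
Qed.

Lemma clip_dist_tail c u q : 0 < c -> 1 <= q ->
  `|u - clip c u| <= c `^ (1 - q) * `|u| `^ q.
Proof.
move=> c0 q1; have [uc|cu] := leP `|u| c.
  by rewrite clip_id// subrr normr0 mulr_ge0 ?powR_ge0.
rewrite (le_trans (ler_dist_clip_norm _ (ltW c0)))//.
by rewrite -{1}[`|u|]powRr1// powR_tail_le// ltW.
Qed.

(** If the left side is nonzero, the larger of [|u|] and [|v|] exceeds b, and its square dominates
    the product. This pointwise bound replaces Hölder's inequality for the pair. *)
Lemma clip_distM_tail b u v q : 0 < b -> 2 <= q ->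
  `|u - clip b u| * `|v| <= b `^ (2 - q) * (`|u| `^ q + `|v| `^ q).
Proof.
move=> b0 q2; have [ub|bu] := leP `|u| b.
  by rewrite clip_id// subrr normr0 mul0r mulr_ge0 ?addr_ge0 ?powR_ge0.
have le2 : `|u - clip b u| * `|v| <= `|u| * `|v|.
  by rewrite ler_wpM2r// ler_dist_clip_norm// ltW.
apply: (le_trans le2).
pose m := Num.max `|u| `|v|.
have bm : b <= m by rewrite /m le_max (ltW bu).
apply: (@le_trans _ _ (m `^ 2)).
  rewrite powR_mulrn /m ?le_max ?normr_ge0// expr2.
  by apply: ler_pM => //; rewrite le_max lexx ?orbT.
apply: (le_trans (powR_tail_le b0 bm q2)).
rewrite ler_wpM2l ?powR_ge0// /m; case: (leP `|u| `|v|) => _.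
  by rewrite lerDr powR_ge0.
by rewrite lerDl powR_ge0.
Qed.

(** The factors are truncated one at a time. The error of the second is multiplied by at most b <=
    a, which turns a^(1-q) into a^(2-q). *)
Lemma clipM_dist a b u v q : 0 < b -> b <= a -> 2 <= q ->
  `|u * v - clip b u * clip a v| <=
  b `^ (2 - q) * (`|u| `^ q + `|v| `^ q) + a `^ (2 - q) * `|v| `^ q.
Proof.
move=> b0 ba q2; have a0 : 0 < a by apply: lt_le_trans ba.
rewrite (_ : _ - _ = (u - clip b u) * v + clip b u * (v - clip a v)); last by ring.
rewrite (le_trans (ler_normD _ _))// !normrM lerD ?clip_distM_tail//.
have q1 : 1 <= q by lra.
rewrite (le_trans (ler_pM _ _ (normr_clip_le u (ltW b0)) (clip_dist_tail v a0 q1)))//.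
rewrite mulrA ler_wpM2r ?powR_ge0//.
rewrite (le_trans (ler_wpM2r (powR_ge0 _ _) ba))//.
have {1}-> : a = a `^ 1 by rewrite powRr1// ltW.
by rewrite -powRD ?(gt_eqF a0) ?implybT// addrA.
Qed.

End Truncation.

(** * Integration against kernels *)

Section WeightedKernelIntegral.
Local Open Scope ereal_scope.
Import HBNNSimple.

(* No measurability is required: it is not known for the inner integral of
   dist_Lnorm as a function of the outer variable. *)
Lemma ge0_le_integral_nonmeasurable d (T : measurableType d) (R : realType)
    (mu : {measure set T -> \bar R}) (D : set T) (f g : T -> \bar R) :
  (forall x, D x -> 0 <= f x) -> (forall x, D x -> f x <= g x) ->
  \int[mu]_(x in D) f x <= \int[mu]_(x in D) g x.
Proof.
move=> f0 fg; rewrite !ge0_integralE //; last first.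
  by move=> x Dx; apply: le_trans (fg _ Dx); exact: f0.
rewrite ge_ereal_sup// => _ [h/= hf] <-.
apply: ereal_sup_ubound; exists h => // x /=; apply: (le_trans (hf x)).
by rewrite /patch; case: ifPn => //; rewrite inE; exact: fg.
Qed.

Context d1 d2 (T1 : measurableType d1) (T2 : measurableType d2) (R : realType).
Variables (mu : {measure set T1 -> \bar R}) (k : R.-ker T1 ~> T2).

Lemma measurable_kernel_integral (f : T2 -> \bar R) :
  measurable_fun setT f -> (forall y, 0 <= f y) ->
  measurable_fun setT (fun x => \int[k x]_y f y).
Proof.
move=> mf f0; apply: measurable_fun_integral_kernel => // U mU.
exact: measurable_kernel.
Qed.

Variable w : T1 -> R.
Hypotheses (mw : measurable_fun setT w) (w0 : forall x, (0 <= w x)%R).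

Let mEw : measurable_fun setT (EFin \o w).
Proof. exact/measurable_EFinP. Qed.

Let Ew0 x : 0 <= (w x)%:E.
Proof. by rewrite lee_fin. Qed.

Lemma integral_weighted_nnsfun (f : {nnsfun T2 >-> R}) :
  \int[mu]_x ((w x)%:E * \int[k x]_y (f y)%:E) =
  \sum_(r \in range f) r%:E * \int[mu]_x ((w x)%:E * k x (f @^-1` [set r])).
Proof.
have mk (r : R) : measurable_fun setT ((EFin \o w) \* (k ^~ (f @^-1` [set r]))).
  by apply: emeasurable_funM => //; exact: measurable_kernel.
have wk0 (r : R) x : 0 <= (w x)%:E * k x (f @^-1` [set r]) by rewrite mule_ge0.
under eq_integral => x _.
  rewrite integralT_nnsfun sintegralE ge0_mule_fsumr; last first.
    by move=> r; exact: nnsfun_mulemu_ge0.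
  under eq_fsbigr do rewrite muleCA.
  over.
rewrite ge0_integral_fsum//; last 2 first.
- by move=> r; apply: measurable_funeM.
- move=> r x _; have [r0|r0] := leP 0%R r; first by rewrite mule_ge0// lee_fin.
  by rewrite preimage_nnfun0// measure0 !mule0.
apply: eq_fsbigr => r _.
have [r0|r0] := leP 0%R r; first by rewrite ge0_integralZl.
rewrite !integral0_eq ?mule0// => x _; rewrite preimage_nnfun0// measure0 ?mule0//.
Qed.

(** Monotone convergence is used twice, under each [k x] and then under [mu]. *)
Lemma cvg_integral_weighted (f : T2 -> \bar R) (mf : measurable_fun setT f) :
  (forall y, 0 <= f y) ->
  \int[mu]_x ((w x)%:E * \int[k x]_y (nnsfun_approx measurableT mf n y)%:E)
    @[n --> \oo] --> \int[mu]_x ((w x)%:E * \int[k x]_y f y).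
Proof.
move=> f0; pose f_ := nnsfun_approx measurableT mf.
have mf_ n : measurable_fun setT (EFin \o f_ n) by exact/measurable_EFinP.
have ndf y : {homo (fun n => (f_ n y)%:E) : a b / (a <= b)%N >-> a <= b}.
  by move=> a b ab; rewrite lee_fin; exact/lefP/nd_nnsfun_approx.
have ndk x : {homo (fun n => \int[k x]_y (f_ n y)%:E) : a b / (a <= b)%N >-> a <= b}.
  move=> a b ab; apply: ge0_le_integral => //.
  - by move=> y _; rewrite lee_fin.
  - exact: mf_.
  - exact: mf_.
  - by move=> y _; exact: ndf.
have cvk x : \int[k x]_y (f_ n y)%:E @[n --> \oo] --> \int[k x]_y f y.
  have -> : \int[k x]_y f y = \int[k x]_y limn (fun n => (f_ n y)%:E).
    by apply: eq_integral => y _; apply/esym/cvg_lim => //; exact: cvg_nnsfun_approx.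
  by apply: cvg_monotone_convergence => // n y _; rewrite lee_fin.
have -> : \int[mu]_x ((w x)%:E * \int[k x]_y f y) =
    \int[mu]_x limn (fun n => (w x)%:E * \int[k x]_y (f_ n y)%:E).
  by apply: eq_integral => x _; apply/esym/cvg_lim => //; exact: cvgeZl.
apply: cvg_monotone_convergence => //.
- move=> n; apply: emeasurable_funM => //.
  apply: measurable_kernel_integral; first exact: mf_.
  by move=> y; rewrite lee_fin.
- by move=> n x _; rewrite mule_ge0// integral_ge0// => y _; rewrite lee_fin.
- by move=> x _ a b ab; rewrite lee_wpmul2l// ndk.
Qed.

End WeightedKernelIntegral.

Section EqWeightedKernelIntegral.
Import HBNNSimple.

(** Both sides are limits along the same simple functions approximating f, and on simple functions
    they agree level set by level set. The weights allow the lemma to be applied once for each of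
    the two factors of a product. *)
Lemma eq_integral_weighted d1 d2 d3 (T1 : measurableType d1)
    (T2 : measurableType d2) (T : measurableType d3) (R : realType)
    (mu1 : {measure set T1 -> \bar R}) (mu2 : {measure set T2 -> \bar R})
    (k1 : R.-ker T1 ~> T) (k2 : R.-ker T2 ~> T)
    (w1 : T1 -> R) (w2 : T2 -> R) (f : T -> \bar R) :
  measurable_fun setT w1 -> measurable_fun setT w2 ->
  (forall x, 0 <= w1 x) -> (forall x, 0 <= w2 x) ->
  (forall A, measurable A ->
    \int[mu1]_x ((w1 x)%:E * k1 x A) = \int[mu2]_x ((w2 x)%:E * k2 x A))%E ->
  measurable_fun setT f -> (forall y, 0 <= f y)%E ->
  (\int[mu1]_x ((w1 x)%:E * \int[k1 x]_y f y) =
   \int[mu2]_x ((w2 x)%:E * \int[k2 x]_y f y))%E.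
Proof.
move=> mw1 mw2 w10 w20 h mf f0.
have c1 := cvg_integral_weighted (mu := mu1) (k := k1) mw1 w10 mf f0.
have c2 := cvg_integral_weighted (mu := mu2) (k := k2) mw2 w20 mf f0.
apply: (cvg_unique _ _ c2) => //; apply: cvg_trans c1.
apply: near_eq_cvg; near=> n => /=.
rewrite !integral_weighted_nnsfun//.
by apply: eq_fsbigr => r _; rewrite h.
Unshelve. all: by end_near. Qed.

End EqWeightedKernelIntegral.

(** * Two-point laws of a stationary Markov process *)

Section StationaryMarkov.
Context {R : realType} {d d' : measure_display} {T : measurableType d}
  {Omega : measurableType d'} (PP : probability Omega R).
Variables (P : nat -> R.-pker T ~> T) (Pi : probability T R)
  (X : nat -> {RV PP >-> T}).
Hypothesis stat : stationary_markov_process P Pi X.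
Implicit Types (s k : nat) (A B : set T).

Let measurable_X s : measurable_fun setT (X s).
Proof. exact: measurable_funPT. Qed.

Let measurable_preX s B : measurable B -> measurable (X s @^-1` B).
Proof. by move=> mB; rewrite -[_ @^-1` _]setTI; exact: measurable_X. Qed.

Lemma history_preimage s B : measurable B -> history X s (X s @^-1` B).
Proof.
move=> mB; apply: sub_sigma_algebra; exists s => //=.
by exists B => //; rewrite setTI.
Qed.

Lemma markov_pair s k A B : measurable A -> measurable B ->
  PP (X s @^-1` B `&` X (s + k)%N @^-1` A) =
  (\int[PP]_(w in X s @^-1` B) P k (X s w) A)%E.
Proof.
by move=> mA mB; have [_ _ + _] := stat; apply => //; exact: history_preimage.
Qed.

Let integral_X0 (g : T -> \bar R) :
  measurable_fun setT g -> (forall x, 0 <= g x)%E ->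
  (\int[PP]_w g (X 0%N w) = \int[Pi]_x g x)%E.
Proof.
move=> mg g0; rewrite -[LHS]ge0_integral_distribution//.
by apply: eq_measure_integral => A mA _; have [_ _ _] := stat; exact.
Qed.

(** The Markov property from time 0 to time s, with the whole space as past event, reduces this to
    invariance under [P s]. *)
Lemma stationary_marginal s A : measurable A -> PP (X s @^-1` A) = Pi A.
Proof.
move=> mA; have [_ [inv _] _ _] := stat.
have := markov_pair 0 s mA measurableT.
rewrite preimage_setT setTI add0n => ->.
rewrite -(inv s)// (integral_X0 (g := P s ^~ A))//.
exact: measurable_kernel.
Qed.

Lemma ge0_integral_marginal s (g : T -> \bar R) :
  measurable_fun setT g -> (forall x, 0 <= g x)%E ->
  (\int[PP]_w g (X s w) = \int[Pi]_x g x)%E.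
Proof.
move=> mg g0; rewrite -[LHS]ge0_integral_distribution//.
by apply: eq_measure_integral => A mA _; exact: stationary_marginal.
Qed.

Lemma markov_pair_invariant s k A B : measurable A -> measurable B ->
  PP (X s @^-1` B `&` X (s + k)%N @^-1` A) =
  (\int[Pi]_x ((\1_B x)%:E * P k x A))%E.
Proof.
move=> mA mB; rewrite markov_pair// integral_mkcond.
have mBA : measurable_fun setT (fun x => (\1_B x)%:E * P k x A)%E.
  by apply: emeasurable_funM; [exact/measurable_EFinP|exact: measurable_kernel].
rewrite -(ge0_integral_marginal s mBA); last first.
  by move=> x; rewrite mule_ge0// lee_fin.
apply: eq_integral => w _; rewrite patchE indicE /=.
have -> : (w \in X s @^-1` B) = (X s w \in B).
  by apply/idP/idP => /set_mem h; exact/mem_set.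
by case: ifPn; rewrite ?mul1e ?mul0e.
Qed.

(** Evaluation at the random variable X_(s+k) is integration against a Dirac kernel, so the Markov
    property becomes an equality of two weighted kernels, with the indicator of B as weight. *)
Let integral_pair_indic s k B (h : T -> R) :
  measurable B -> measurable_fun setT h -> (forall y, 0 <= h y) ->
  (\int[PP]_w (\1_B (X s w) * h (X (s + k)%N w))%:E =
   \int[Pi]_x ((\1_B x)%:E * \int[P k x]_y (h y)%:E))%E.
Proof.
move=> mB mh h0.
have m1 : measurable_fun setT (\1_B \o X s : Omega -> R).
  by apply: measurableT_comp.
rewrite -(@eq_integral_weighted _ _ _ _ _ _ _ PP Pi
    (kdirac (measurable_X (s + k))) (P k) (\1_B \o X s) \1_B)//.
- apply: eq_integral => w _; rewrite integral_dirac ?diracT ?mul1e//.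
  exact/measurable_EFinP.
- move=> A mA; rewrite -(markov_pair_invariant s k mA mB).
  rewrite -[X in PP X]setIT -integral_indic//.
  + apply: eq_integral => w _ /=.
    rewrite /kdirac/= /dirac/= -EFinM !indicE -natrM mulnb; congr (_%:R)%:E.
    congr nat_of_bool; apply/andP/idP => [[/set_mem ? /set_mem ?]|/set_mem[? ?]].
      exact/mem_set.
    by split; exact/mem_set.
  + by apply: measurableI; exact: measurable_preX.
- exact/measurable_EFinP.
Qed.

(** The bound c makes the integral of h under [P k x] a real number, so that it can serve as a
    weight. *)
Lemma ge0_integral_pair s k (g h : T -> R) c :
  measurable_fun setT g -> (forall x, 0 <= g x) ->
  measurable_fun setT h -> (forall y, 0 <= h y <= c) ->
  (\int[PP]_w (g (X s w) * h (X (s + k)%N w))%:E =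
   \int[Pi]_x ((g x)%:E * \int[P k x]_y (h y)%:E))%E.
Proof.
move=> mg g0 mh h0c.
have h0 y : 0 <= h y by have /andP[] := h0c y.
have mEh : measurable_fun setT (EFin \o h) by exact/measurable_EFinP.
have Ph_fin x : (\int[P k x]_y (h y)%:E)%E \is a fin_num.
  rewrite ge0_fin_numE; last by apply: integral_ge0 => y _; rewrite lee_fin.
  apply: (@le_lt_trans _ _ (\int[P k x]_y (cst c%:E) y)%E).
    apply: ge0_le_integral => //; first by move=> y _; rewrite lee_fin.
    by move=> y _; rewrite lee_fin; have /andP[] := h0c y.
  by rewrite integral_cst//= prob_kernel mule1 ltry.
have mPh : measurable_fun setT (fun x => fine (\int[P k x]_y (h y)%:E)%E).
  by apply: measurableT_comp => //; apply: measurable_kernel_integral.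
(* Second extension, with the roles exchanged: h at time s + k and its kernel integral are the
   weights, and g is the integrand. The hypothesis on sets is the indicator case already proved. *)
have := @eq_integral_weighted _ _ _ _ _ _ _ PP Pi
    (kdirac (measurable_X s)) (kdirac (@measurable_id _ _ setT))
    (h \o X (s + k)%N) (fun x => fine (\int[P k x]_y (h y)%:E)%E) (EFin \o g).
under eq_integral => w _.
  rewrite integral_dirac ?diracT ?mul1e//=; last exact/measurable_EFinP.
  rewrite -EFinM mulrC; over.
move=> ->//.
- apply: eq_integral => x _; rewrite integral_dirac ?diracT ?mul1e//=; last first.
    exact/measurable_EFinP.
  by rewrite fineK// muleC.
- exact: measurableT_comp.
- by move=> w /=.
- by move=> x; rewrite fine_ge0// integral_ge0// => y _; rewrite lee_fin.
- move=> A mA; under [RHS]eq_integral do rewrite fineK// muleC.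
  rewrite -(integral_pair_indic s k mA mh h0).
  by apply: eq_integral => w _; rewrite /= /kdirac /dirac /= -EFinM mulrC.
- exact/measurable_EFinP.
Qed.

End StationaryMarkov.

(** * Lipschitz functions and the bounded-Lipschitz distance *)

Section LipschitzFunctions.
Context {R : realType} {S : pointedMetricType R}.
Implicit Types (f : S -> R) (l a c : R).

Definition lipschitz_bound l f :=
  forall x y, `|f y - f x| <= l * mdist x y.

Lemma lip_norm_ge0 f : (0 <= lip_norm f)%E.
Proof. by rewrite /lip_norm le_max lexx. Qed.

Lemma lip_normP f l : lip_norm f = l%:E -> lipschitz_bound l f.
Proof.
move=> fl x y; have [->|xy] := eqVneq x y.
  by rewrite subrr normr0 mulr_ge0 ?mdist_ge0// -lee_fin -fl lip_norm_ge0.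
rewrite -ler_pdivrMr ?mdist_gt0// -lee_fin -fl /lip_norm le_max.
by apply/orP; right; apply: ereal_sup_ubound; exists (x, y).
Qed.

Lemma lip_norm_le f l : 0 <= l -> lipschitz_bound l f ->
  (lip_norm f <= l%:E)%E.
Proof.
move=> l0 fl; rewrite /lip_norm ge_max lee_fin l0/=.
apply: ge_ereal_sup => _ [[x y] /= xy <-]; rewrite lee_fin.
by rewrite ler_pdivrMr ?mdist_gt0.
Qed.

Lemma sup_norm_le f a : (forall x, `|f x| <= a) -> (sup_norm f <= a%:E)%E.
Proof. by move=> fa; apply: ge_ereal_sup => _ [x _ <-]; rewrite lee_fin. Qed.

Lemma lipschitz_bound_continuous f l : lipschitz_bound l f -> continuous f.
Proof.
move=> fl x; apply/cvgrPdist_lt => e e0.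
(* Adding 1 keeps the radius below meaningful for l = 0. *)
have l0 : 0 < `|l| + 1 by rewrite ltr_wpDl.
have e0' : 0 < e / (`|l| + 1) by rewrite divr_gt0.
apply: filterS (nbhsx_ballx x _ e0') => y; rewrite ballEmdist/= => xy.
rewrite distrC (le_lt_trans (fl _ _))//.
apply: (@le_lt_trans _ _ ((`|l| + 1) * mdist x y)).
  by rewrite ler_wpM2r ?mdist_ge0// (le_trans (ler_norm _))// lerDl.
by rewrite mulrC -ltr_pdivlMr.
Qed.

Lemma continuous_borel_measurable f :
  continuous f -> measurable_fun setT (f : borel S -> R).
Proof.
move=> /continuousP cf; apply: (measurability _ (RGenOpens.measurableE R)).
move=> _ [_ [a [b ->] <-]]; rewrite setTI; apply: sub_sigma_algebra.
exact/cf/interval_open.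
Qed.

Lemma lipschitz_bound_measurable f l :
  lipschitz_bound l f -> measurable_fun setT (f : borel S -> R).
Proof.
by move=> /lipschitz_bound_continuous; exact: continuous_borel_measurable.
Qed.

Lemma lipschitz_bound_clip f l c :
  lipschitz_bound l f -> lipschitz_bound l (clip c \o f).
Proof. by move=> fl x y; exact: le_trans (ler_dist_clip _ _ _) (fl _ _). Qed.

Lemma bounded_integrable d (T : measurableType d)
    (mu : {measure set T -> \bar R}) (f : T -> R) a :
  (mu setT < +oo)%E -> measurable_fun setT f -> (forall x, `|f x| <= a) ->
  mu.-integrable setT (EFin \o f).
Proof.
move=> muoo mf fa; apply: measurable_bounded_integrable => //.
exists a; split; first exact: num_real.
by move=> b ab x _ /=; exact: le_trans (fa x) (ltW ab).
Qed.

(** Divided by l + a, the function f is admissible in the supremum defining [bl_dist]. *)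
Lemma bl_dist_integral (mu nu : {measure set (borel S) -> \bar R}) f l a b :
  (mu setT < +oo)%E -> (nu setT < +oo)%E ->
  0 < l + a -> 0 <= l -> lipschitz_bound l f -> (forall x, `|f x| <= a) ->
  (bl_dist mu nu <= b%:E)%E ->
  `|\int[mu]_x f x - \int[nu]_x f x| <= (l + a) * b.
Proof.
move=> muoo nuoo la0 l0 fl fa blb.
have mf := lipschitz_bound_measurable fl.
pose g x := (l + a)^-1 * f x.
have gE (m : {measure set (borel S) -> \bar R}) : (m setT < +oo)%E ->
    (\int[m]_x (g x)%:E = ((l + a)^-1 * \int[m]_x f x)%:E)%E.
  move=> moo; have intf := bounded_integrable moo mf fa.
  rewrite EFinM fineK; last exact: integrable_fin_num.
  by rewrite -integralZl.
have : (`|\int[mu]_x (g x)%:E - \int[nu]_x (g x)%:E| <= bl_dist mu nu)%E.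
  apply: ereal_sup_ubound; exists g => //=.
  have -> : 1%E = (l / (l + a))%:E + (a / (l + a))%:E :> \bar R.
    by rewrite -EFinD -mulrDl divff// gt_eqF.
  apply: leeD.
    apply: lip_norm_le; first by rewrite divr_ge0// ltW.
    move=> x y; rewrite /g -mulrBr normrM gtr0_norm ?invr_gt0// mulrC.
    by rewrite mulrAC ler_pM2r ?invr_gt0.
  apply: sup_norm_le => x; rewrite /g normrM gtr0_norm ?invr_gt0// mulrC.
  by rewrite ler_pM2r ?invr_gt0.
move=> /le_trans /(_ blb); rewrite !gE// -EFinB abse_EFin lee_fin -mulrBr normrM.
by rewrite gtr0_norm ?invr_gt0// ler_pdivrMl.
Qed.

End LipschitzFunctions.

Lemma probability_Rintegral_cst {d} {T : measurableType d} {R : realType}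
    (mu : probability T R) (c : R) : \int[mu]_x c = c.
Proof.
rewrite Rintegral_cst// -[RHS]mulr1; congr (_ * _).
by rewrite -[RHS]/(fine 1%E); congr fine; exact: probability_setT.
Qed.

(** * Covariance of a bounded and a bounded Lipschitz observable *)

Section Covariance.
Context {R : realType} {S : pointedMetricType R} {d : measure_display}
  {Omega : measurableType d} (PP : probability Omega R).
Variables (P : nat -> R.-pker (borel S) ~> (borel S))
  (Pi : probability (borel S) R) (X : nat -> {RV PP >-> borel S}).
Hypothesis stat : stationary_markov_process P Pi X.
Variables (M : borel S -> R) (k : nat) (r : R).
Hypotheses (intM : Pi.-integrable setT (EFin \o M))
  (blM : forall x : borel S, (bl_dist (P k x) Pi <= (M x * r)%:E)%E).
Let m := \int[Pi]_x M x.

Let PP_oo : (PP setT < +oo)%E.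
Proof. by rewrite probability_setT ltry. Qed.

Let Pi_oo : (Pi setT < +oo)%E.
Proof. by rewrite probability_setT ltry. Qed.

Let Pk_oo x : (P k x setT < +oo)%E.
Proof. by rewrite prob_kernel ltry. Qed.

Let measurable_comp_RV s (g : borel S -> R) :
  measurable_fun setT g -> measurable_fun setT (g \o X s).
Proof. by move=> mg; apply: measurableT_comp. Qed.

(** The covariance equals ∫ g(x) (∫ h dP_k(x, .) - ∫ h dPi) dPi(x), and the bounded-Lipschitz
    distance bounds the inner difference by (l + a) r M(x). *)
Lemma ge0_lipschitz_covariance_le s (g h : borel S -> R) (a c l : R) :
  measurable_fun setT g -> (forall x, 0 <= g x <= c) ->
  0 < l + a -> 0 <= l -> lipschitz_bound l (h : S -> R) ->
  (forall x, 0 <= h x <= a) ->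
  `|\int[PP]_w (g (X s w) * h (X (s + k)%N w)) -
    (\int[Pi]_x g x) * \int[Pi]_x h x| <= c * (l + a) * r * m.
Proof.
move=> mg g0c la0 l0 hl h0a.
have mh : measurable_fun setT h := lipschitz_bound_measurable hl.
have ga x : `|g x| <= c by have /andP[? ?] := g0c x; rewrite ger0_norm.
have ha x : `|h x| <= a by have /andP[? ?] := h0a x; rewrite ger0_norm.
have c0 : 0 <= c := le_trans (normr_ge0 _) (ga point).
have intg := bounded_integrable Pi_oo mg ga.
pose Ph x := \int[P k x]_y h y.
have PhE x : (\int[P k x]_y (h y)%:E = (Ph x)%:E)%E.
  by rewrite fineK//; apply: integrable_fin_num => //; exact: bounded_integrable ha.
have h0 x : 0 <= h x by have /andP[] := h0a x.
have mPh : measurable_fun setT Ph.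
  apply: measurableT_comp => //.
  by apply: measurable_kernel_integral => //; exact/measurable_EFinP.
have Pha x : `|Ph x| <= a.
  rewrite ger0_norm ?Rintegral_ge0// -lee_fin -PhE.
  apply: (@le_trans _ _ (\int[P k x]_y (cst a%:E) y)%E).
    apply: ge0_le_integral => //; first by move=> y _; rewrite lee_fin.
      exact/measurable_EFinP.
    by move=> y _; rewrite lee_fin; have /andP[] := h0a y.
  by rewrite integral_cst//= prob_kernel mule1.
have intgPh : Pi.-integrable setT (EFin \o (fun x => g x * Ph x)).
  apply: (@bounded_integrable _ _ _ _ _ (c * a)) => //.
    exact: measurable_funM.
  by move=> x; rewrite normrM ler_pM.
have -> : \int[PP]_w (g (X s w) * h (X (s + k)%N w)) = \int[Pi]_x (g x * Ph x).
  rewrite /Rintegral (ge0_integral_pair stat s k mg _ mh h0a); last first.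
    by move=> x; have /andP[] := g0c x.
  by congr fine; apply: eq_integral => x _; rewrite PhE -EFinM.
rewrite -RintegralZr// -RintegralB//; last first.
  by apply: (@integrableZr _ _ _ _ _ measurableT (\int[Pi]_x h x) (EFin \o g)).
have intB : Pi.-integrable setT
    (EFin \o (fun x => g x * Ph x - g x * \int[Pi]_x h x)).
  apply: (@bounded_integrable _ _ _ _ _ (c * (a + `|\int[Pi]_x h x|))) => //.
    by apply: measurable_funB; apply: measurable_funM.
  move=> x; rewrite -mulrBr normrM ler_pM// (le_trans (ler_normB _ _))//.
  by rewrite lerD2r.
rewrite (le_trans (le_normr_Rintegral _ _))// /m -RintegralZl//.
apply: le_Rintegral => //.
- exact: integrable_norm.
- by apply: (@integrableZl _ _ _ _ _ measurableT (c * (l + a) * r) (EFin \o M)).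
- move=> x _; rewrite -mulrBr normrM -!mulrA ler_pM//.
  by rewrite (mulrC r); apply: bl_dist_integral.
Qed.

(** Adding b to g and a to h makes both nonnegative without changing the covariance or the Lipschitz
    bound; the sup bounds double. *)
Lemma lipschitz_covariance_le s (g h : borel S -> R) (a b l : R) :
  measurable_fun setT g -> (forall x, `|g x| <= b) ->
  0 < a -> 0 <= l -> lipschitz_bound l (h : S -> R) -> (forall x, `|h x| <= a) ->
  `|\int[PP]_w (g (X s w) * h (X (s + k)%N w)) -
    (\int[Pi]_x g x) * \int[Pi]_x h x| <= 2 * b * (l + 2 * a) * r * m.
Proof.
move=> mg gb a0 l0 hl ha.
have mh : measurable_fun setT h := lipschitz_bound_measurable hl.
have b0 : 0 <= b := le_trans (normr_ge0 _) (gb point).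
pose G x := g x + b; pose H x := h x + a.
have G2 x : 0 <= G x <= 2 * b.
  by have := gb x; rewrite ler_norml /G => /andP[]; lra.
have H2 x : 0 <= H x <= 2 * a.
  by have := ha x; rewrite ler_norml /H => /andP[]; lra.
have mG : measurable_fun setT G by apply: measurable_funD.
have Hl : lipschitz_bound l (H : S -> R).
  by move=> x y; rewrite /H opprD addrACA subrr addr0.
have mH : measurable_fun setT H := lipschitz_bound_measurable Hl.
have la0 : 0 < l + 2 * a by lra.
have := ge0_lipschitz_covariance_le s mG G2 la0 l0 Hl H2.
have ig := bounded_integrable Pi_oo mg gb.
have ih := bounded_integrable Pi_oo mh ha.
have icst t : Pi.-integrable setT (EFin \o (fun _ : borel S => t)).
  exact: finite_measure_integrable_cst.
have EG : \int[Pi]_x G x = \int[Pi]_x g x + b.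
  by rewrite RintegralD// probability_Rintegral_cst.
have EH : \int[Pi]_x H x = \int[Pi]_x h x + a.
  by rewrite RintegralD// probability_Rintegral_cst.
have mgX := measurable_comp_RV s mg.
have mhX := measurable_comp_RV (s + k) mh.
have igX : PP.-integrable setT (EFin \o (g \o X s)).
  by apply: (@bounded_integrable _ _ _ _ _ b) => // w /=.
have ihX : PP.-integrable setT (EFin \o (h \o X (s + k)%N)).
  by apply: (@bounded_integrable _ _ _ _ _ a) => // w /=.
have ighX : PP.-integrable setT (EFin \o (fun w => g (X s w) * h (X (s + k)%N w))).
  apply: (@bounded_integrable _ _ _ _ _ (b * a)) => //.
    exact: measurable_funM.
  by move=> w; rewrite normrM ler_pM.
have EgX : \int[PP]_w g (X s w) = \int[Pi]_x g x.
  have : \int[PP]_w G (X s w) = \int[Pi]_x G x.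
    rewrite /Rintegral (ge0_integral_marginal stat s (g := EFin \o G))//.
      exact/measurable_EFinP.
    by move=> x; rewrite lee_fin; have /andP[] := G2 x.
  rewrite EG RintegralD//; last exact: finite_measure_integrable_cst.
  by rewrite probability_Rintegral_cst => /addIr.
have EhX : \int[PP]_w h (X (s + k)%N w) = \int[Pi]_x h x.
  have : \int[PP]_w H (X (s + k)%N w) = \int[Pi]_x H x.
    rewrite /Rintegral (ge0_integral_marginal stat (s + k)%N (g := EFin \o H))//.
      exact/measurable_EFinP.
    by move=> x; rewrite lee_fin; have /andP[] := H2 x.
  rewrite EH RintegralD//; last exact: finite_measure_integrable_cst.
  by rewrite probability_Rintegral_cst => /addIr.
(* The three extra terms also occur in the product of the means of G and H, so they cancel. *)
suff -> : \int[PP]_w (G (X s w) * H (X (s + k)%N w)) =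
    \int[PP]_w (g (X s w) * h (X (s + k)%N w)) + a * \int[Pi]_x g x
    + b * \int[Pi]_x h x + a * b.
  rewrite EG EH; move: (Rintegral PP _ _) (Rintegral Pi _ _) (Rintegral Pi _ _).
  by move=> u v w; congr (`|_| <= _); ring.
have -> : (fun w => G (X s w) * H (X (s + k)%N w)) = (fun w =>
    (g (X s w) * h (X (s + k)%N w) + a * g (X s w)) +
    (b * h (X (s + k)%N w) + a * b)).
  by apply/funext => w; rewrite /G /H; ring.
have iag : PP.-integrable setT (EFin \o (fun w => a * g (X s w))).
  exact: (@integrableZl _ _ _ _ _ measurableT a (EFin \o (g \o X s))).
have ibh : PP.-integrable setT (EFin \o (fun w => b * h (X (s + k)%N w))).
  exact: (@integrableZl _ _ _ _ _ measurableT b (EFin \o (h \o X (s + k)%N))).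
have iab : PP.-integrable setT (EFin \o (fun _ : Omega => a * b)).
  exact: finite_measure_integrable_cst.
rewrite RintegralD//; last 2 first.
- by apply: (integrableD _ ighX iag).
- by apply: (integrableD _ ibh iab).
rewrite !RintegralD// probability_Rintegral_cst. rewrite !RintegralZl//.
by rewrite EgX EhX addrA.
Qed.

End Covariance.

(** * Decay of covariances *)

Section CovarianceTruncation.
Context {R : realType} {S : pointedMetricType R} {d : measure_display}
  {Omega : measurableType d} (PP : probability Omega R).
Variables (P : nat -> R.-pker (borel S) ~> (borel S))
  (Pi : probability (borel S) R) (X : nat -> {RV PP >-> borel S}).
Hypothesis stat : stationary_markov_process P Pi X.
Variables (f : S -> R) (l q : R).
Hypotheses (l0 : 0 <= l) (fl : lipschitz_bound l f) (q2 : 2 <= q)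
  (fq : Pi.-integrable setT (EFin \o (fun x : borel S => `|f x| `^ q)))
  (f0 : \int[Pi]_x f x = 0).
Let G := \int[Pi]_x (`|f x| `^ q).

Let mf : measurable_fun setT (f : borel S -> R).
Proof. exact: lipschitz_bound_measurable fl. Qed.

Let PP_oo : (PP setT < +oo)%E.
Proof. by rewrite probability_setT ltry. Qed.

Let Pi_oo : (Pi setT < +oo)%E.
Proof. by rewrite probability_setT ltry. Qed.

Lemma integrable_marginal s (g : borel S -> R) :
  Pi.-integrable setT (EFin \o g) -> PP.-integrable setT (EFin \o (g \o X s)).
Proof.
move=> /integrableP[/measurable_EFinP mg goo]; apply/integrableP; split.
  by apply/measurable_EFinP; apply: measurableT_comp.
rewrite (ge0_integral_marginal stat s (g := fun x => `|(g x)%:E|%E))//.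
by apply/measurable_EFinP; exact: measurableT_comp.
Qed.

Lemma ge0_Rintegral_marginal s (g : borel S -> R) :
  measurable_fun setT g -> (forall x, 0 <= g x) ->
  \int[PP]_w g (X s w) = \int[Pi]_x g x.
Proof.
move=> mg g0; rewrite /Rintegral (ge0_integral_marginal stat s (g := EFin \o g))//.
exact/measurable_EFinP.
Qed.

Let powq_measurable t : measurable_fun setT (fun x : borel S => `|f x| `^ t).
Proof.
apply: (measurableT_comp (measurable_powR t)).
exact: (measurableT_comp (@normr_measurable R setT)).
Qed.

Lemma integrable_pow_le (t : R) : 0 <= t <= q ->
  Pi.-integrable setT (EFin \o (fun x : borel S => `|f x| `^ t)).
Proof.
move=> /andP[t0 tq].
have i1 : Pi.-integrable setT (EFin \o (fun _ : borel S => 1 : R)).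
  exact: finite_measure_integrable_cst.
apply: le_integrable (integrableD _ i1 fq) => //.
  exact/measurable_EFinP.
move=> x _ /=; rewrite lee_fin (ger0_norm (powR_ge0 _ _)).
rewrite (ger0_norm (addr_ge0 ler01 (powR_ge0 _ _))).
have [fx1|fx1] := leP `|f x| 1.
  apply: ler_wpDr; first exact: powR_ge0.
  (* Monotonicity in the exponent needs a positive base; 0 to the power t is 1 for t = 0 and 0
     otherwise. *)
  have [->|fx0] := eqVneq `|f x| 0.
    by have [->|t0'] := eqVneq t 0; rewrite ?powRr0// powR0.
  by rewrite -[X in _ <= X](powRr0 `|f x|) ger_powR// lt0r fx0 normr_ge0.
by apply: ler_wpDl => //; apply: ler_powR => //; exact: ltW.
Qed.

Lemma integrable_sqr : Pi.-integrable setT (EFin \o (fun x : borel S => f x ^+ 2)).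
Proof.
have -> : (fun x : borel S => f x ^+ 2) = (fun x => `|f x| `^ 2).
  by apply/funext => x; rewrite powR_mulrn// real_normK// num_real.
by apply: integrable_pow_le; rewrite q2 andbT.
Qed.

Let V := \int[Pi]_x (f x ^+ 2).

Lemma integrable_pair s t :
  PP.-integrable setT (EFin \o (fun w => f (X s w) * f (X t w))).
Proof.
have mfX u : measurable_fun setT ((f : borel S -> R) \o X u).
  exact: measurableT_comp.
apply: le_integrable (integrableD _ (integrable_marginal s integrable_sqr)
  (integrable_marginal t integrable_sqr)) => //.
  by apply/measurable_EFinP; apply: measurable_funM; exact: mfX.
move=> w _ /=; rewrite lee_fin normrM.
rewrite [leRHS]ger0_norm ?addr_ge0 ?sqr_ge0//.
rewrite -(real_normK (num_real (f (X s w)))) -(real_normK (num_real (f (X t w)))).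
have := sqr_ge0 (`|f (X s w)| - `|f (X t w)|).
have := normr_ge0 (f (X s w)); have := normr_ge0 (f (X t w)).
by move: `|_| `|_| => u v; nra.
Qed.

(** Both marginals are [Pi], so |u v| <= (u^2 + v^2) / 2 does the work of Cauchy-Schwarz. *)
Lemma covariance_le_variance s t :
  `|\int[PP]_w (f (X s w) * f (X t w))| <= V.
Proof.
have i2 u : PP.-integrable setT (EFin \o (fun w => 2^-1 * f (X u w) ^+ 2)).
  exact: (@integrableZl _ _ _ _ _ measurableT 2^-1 _
    (integrable_marginal u integrable_sqr)).
have E u : \int[PP]_w (2^-1 * f (X u w) ^+ 2) = 2^-1 * V.
  rewrite RintegralZl//; last exact: (integrable_marginal u integrable_sqr).
  congr (_ * _); apply: (ge0_Rintegral_marginal u (g := fun x => f x ^+ 2)).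
    exact: measurable_funX.
  by move=> x; exact: sqr_ge0.
rewrite (le_trans (le_normr_Rintegral _ _))//; first exact: integrable_pair.
apply: (@le_trans _ _ (\int[PP]_w (2^-1 * f (X s w) ^+ 2 + 2^-1 * f (X t w) ^+ 2))).
  apply: le_Rintegral => //.
  - exact: integrable_norm (integrable_pair s t).
  - exact: (integrableD _ (i2 s) (i2 t)).
  - move=> w _; rewrite normrM.
    rewrite -(real_normK (num_real (f (X s w)))) -(real_normK (num_real (f (X t w)))).
    have := sqr_ge0 (`|f (X s w)| - `|f (X t w)|).
    by move: `|_| `|_| => u v; nra.
by rewrite RintegralD// !E; lra.
Qed.

Section Decay.
Variables (M : borel S -> R) (k : nat) (r : R).
Hypotheses (intM : Pi.-integrable setT (EFin \o M))
  (blM : forall x : borel S, (bl_dist (P k x) Pi <= (M x * r)%:E)%E)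
  (r01 : 0 < r <= 1).
Let m := \int[Pi]_x M x.

(** Three errors add up: truncating inside the expectation costs two b-tails and one a-tail, the
    covariance of the truncations costs 6 a b r m, and the product of their means costs the second
    a-tail. *)
Lemma covariance_truncation_le s (a b : R) : 0 < b -> b <= a -> l <= a -> 0 <= m ->
  `|\int[PP]_w (f (X s w) * f (X (s + k)%N w))| <=
  6 * (a * b * r * m) + 2 * b `^ (2 - q) * G + 2 * a `^ (2 - q) * G.
Proof.
move=> b0 ba la m0; have a0 : 0 < a by apply: lt_le_trans ba.
have q1 : 1 <= q by apply: le_trans q2; rewrite ler1n.
pose fa : borel S -> R := clip a \o f.
pose fb : borel S -> R := clip b \o f.
have mfa : measurable_fun setT fa.
  exact: lipschitz_bound_measurable (lipschitz_bound_clip a fl).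
have mfb : measurable_fun setT fb.
  exact: lipschitz_bound_measurable (lipschitz_bound_clip b fl).
have fa_le x : `|fa x| <= a by apply: normr_clip_le; exact: ltW.
have fb_le x : `|fb x| <= b by apply: normr_clip_le; exact: ltW.
have cov := lipschitz_covariance_le stat intM blM s mfb fb_le a0 l0
  (lipschitz_bound_clip a fl) fa_le.
have ifa := bounded_integrable Pi_oo mfa fa_le.
have ifb := bounded_integrable Pi_oo mfb fb_le.
have if1 : Pi.-integrable setT (EFin \o (f : borel S -> R)).
  apply: le_integrable (@integrable_pow_le 1 _) => //.
  - exact/measurable_EFinP.
  - by move=> x _ /=; rewrite lee_fin powRr1// normr_id.
  - by rewrite ler01.
(* Since f has mean 0, the mean of its truncation is minus the mean of what was cut off. *)
have mean_fa : `|\int[Pi]_x fa x| <= a `^ (1 - q) * G.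
  rewrite -normrN -[X in `|X|]add0r -f0 -RintegralB//.
  rewrite (le_trans (le_normr_Rintegral _ _))//.
    exact: (integrableB _ if1 ifa).
  rewrite /G -RintegralZl//; apply: le_Rintegral => //.
  - exact: integrable_norm (integrableB _ if1 ifa).
  - exact: (@integrableZl _ _ _ _ _ measurableT (a `^ (1 - q)) _ fq).
  - by move=> x _; exact: clip_dist_tail.
have mean_fb : `|\int[Pi]_x fb x| <= b.
  rewrite (le_trans (le_normr_Rintegral _ _))//.
  rewrite -[leRHS](probability_Rintegral_cst Pi); apply: le_Rintegral => //.
  - exact: integrable_norm.
  - exact: finite_measure_integrable_cst.
have G0 : 0 <= G by apply: Rintegral_ge0 => x _; exact: powR_ge0.
have mean_prod : `|(\int[Pi]_x fb x) * \int[Pi]_x fa x| <= a `^ (2 - q) * G.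
  rewrite normrM (le_trans (ler_pM _ _ mean_fb mean_fa))//.
  rewrite mulrA ler_wpM2r// (le_trans (ler_wpM2r (powR_ge0 _ _) ba))//.
  have {1}-> : a = a `^ 1 by rewrite powRr1// ltW.
  by rewrite -powRD ?(gt_eqF a0) ?implybT// addrA.
have ipair := integrable_pair s (s + k)%N.
have mX u (g : borel S -> R) : measurable_fun setT g -> measurable_fun setT (g \o X u).
  by move=> mg; apply: measurableT_comp.
have ipab : PP.-integrable setT (EFin \o (fun w => fb (X s w) * fa (X (s + k)%N w))).
  apply: (@bounded_integrable _ _ _ _ _ (b * a)) => //.
    by apply: measurable_funM; exact: mX.
  by move=> w; rewrite normrM ler_pM.
have iq u : PP.-integrable setT (EFin \o (fun w => `|f (X u w)| `^ q)).
  exact: (integrable_marginal u fq).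
have Eq u : \int[PP]_w (`|f (X u w)| `^ q) = G.
  exact: (ge0_Rintegral_marginal u (g := fun x => `|f x| `^ q)).
have Ziq (c : R) u : PP.-integrable setT (EFin \o (fun w => c * `|f (X u w)| `^ q)).
  exact: (@integrableZl _ _ _ _ _ measurableT c _ (iq u)).
have diff : `|\int[PP]_w (f (X s w) * f (X (s + k)%N w)) -
    \int[PP]_w (fb (X s w) * fa (X (s + k)%N w))| <=
    2 * b `^ (2 - q) * G + a `^ (2 - q) * G.
  rewrite -RintegralB// (le_trans (le_normr_Rintegral _ _))//.
    exact: (integrableB _ ipair ipab).
  apply: (@le_trans _ _ (\int[PP]_w (b `^ (2 - q) * `|f (X s w)| `^ q +
      b `^ (2 - q) * `|f (X (s + k)%N w)| `^ q +
      a `^ (2 - q) * `|f (X (s + k)%N w)| `^ q))).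
    apply: le_Rintegral => //.
    - exact: integrable_norm (integrableB _ ipair ipab).
    - exact: (integrableD _ (integrableD _ (Ziq _ _) (Ziq _ _)) (Ziq _ _)).
    - by move=> w _; rewrite -mulrDr; exact: clipM_dist.
  rewrite RintegralD//; last exact: (integrableD _ (Ziq _ _) (Ziq _ _)).
  by rewrite RintegralD// !RintegralZl// !Eq; lra.
have abrm : 2 * b * (l + 2 * a) * r * m <= 6 * (a * b * r * m).
  have /andP[r0 _] := r01.
  have : 0 <= (b * (a - l)) * (r * m).
    by rewrite mulr_ge0// mulr_ge0 ?subr_ge0// ltW.
  by lra.
have tri (u v w : R) : `|u| <= `|u - v| + `|v - w| + `|w|.
  rewrite {1}(_ : u = u - v + (v - w) + w); last by ring.
  by rewrite (le_trans (ler_normD _ _))// lerD2r ler_normD.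
apply: le_trans (tri _ (\int[PP]_w (fb (X s w) * fa (X (s + k)%N w)))
  ((\int[Pi]_x fb x) * \int[Pi]_x fa x)) _.
apply: (le_trans (lerD (lerD diff (le_trans cov abrm)) mean_prod)).
lra.
Qed.

(** The main term has the factor m^(1-1/q), the b-tail m^(1-2/q) and the a-tail no power of m. As m
    >= 1 the first dominates, and the two tails together give the 4. *)
Lemma covariance_decay s (A : R) : 0 < A -> l <= A * r `^ (- q^-1) -> 1 <= m ->
  `|\int[PP]_w (f (X s w) * f (X (s + k)%N w))| <=
  (6 * A ^+ 2 + 4 * (A `^ (2 - q) * G)) *
    (m `^ (1 - q^-1) * r `^ (1 - 2 * q^-1)).
Proof.
move=> A0 lA m1; have /andP[r0 r1] := r01.
have m0 : 0 < m by apply: lt_le_trans m1.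
have q0 : 0 < q by apply: lt_le_trans q2.
have G0 : 0 <= G by apply: Rintegral_ge0 => x _; exact: powR_ge0.
pose a := A * r `^ (- q^-1); pose b := A * (m * r) `^ (- q^-1).
have b0 : 0 < b by rewrite mulr_gt0// powR_gt0// mulr_gt0.
have m_le1 : m `^ (- q^-1) <= 1.
  by rewrite -[leRHS](powRr0 m) ler_powR// oppr_le0 invr_ge0 (ltW q0).
have ba : b <= a.
  by rewrite ler_pM2l// (powRM _ (ltW m0) (ltW r0)) ler_piMl// powR_ge0.
have abrm : a * b * r * m = A ^+ 2 * (m `^ (1 - q^-1) * r `^ (1 - 2 * q^-1)).
  have -> : 1 - 2 * q^-1 = 1 + (- q^-1 + - q^-1) by ring.
  rewrite !powRD ?(gt_eqF m0) ?(gt_eqF r0) ?implybT//.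
  rewrite (powRr1 (ltW m0)) (powRr1 (ltW r0)) /a /b.
  by rewrite (powRM _ (ltW m0) (ltW r0)); ring.
have expE : - q^-1 * (2 - q) = 1 - 2 * q^-1 by field; rewrite gt_eqF.
have aE : a `^ (2 - q) = A `^ (2 - q) * r `^ (1 - 2 * q^-1).
  by rewrite (powRM _ (ltW A0) (powR_ge0 _ _)) -powRrM expE.
have bE : b `^ (2 - q) = A `^ (2 - q) * (m `^ (1 - 2 * q^-1) * r `^ (1 - 2 * q^-1)).
  by rewrite (powRM _ (ltW A0) (powR_ge0 _ _)) -powRrM expE (powRM _ (ltW m0) (ltW r0)).
apply: (le_trans (covariance_truncation_le s b0 ba lA (ltW m0))).
rewrite abrm aE bE.
have m2 : m `^ (1 - 2 * q^-1) <= m `^ (1 - q^-1).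
  apply: ler_powR => //; apply: lerB => //.
  by rewrite ler_peMl ?invr_ge0 ?(ltW q0)// ler1n.
have mge1 : 1 <= m `^ (1 - q^-1).
  by rewrite -[leLHS](powRr0 m) ler_powR// subr_ge0 invf_le1// (le_trans _ q2)// ler1n.
have T0 : 0 <= A `^ (2 - q) * G * r `^ (1 - 2 * q^-1).
  by rewrite !mulr_ge0// powR_ge0.
have := ler_wpM2l T0 m2; have := ler_wpM2l T0 mge1.
lra.
Qed.

Lemma covariance_decay_sqrt s (A : R) : 0 < A -> l <= A * r `^ (- q^-1) ->
  1 <= m ->
  `|\int[PP]_w (f (X s w) * f (X (s + k)%N w))| <=
  Num.sqrt (V * (6 * A ^+ 2 + 4 * (A `^ (2 - q) * G))) *
    (m `^ (2^-1 * (1 - q^-1)) * r `^ (2^-1 * (1 - 2 * q^-1))).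
Proof.
move=> A0 lA m1; have := covariance_decay s A0 lA m1.
have := covariance_le_variance s (s + k)%N.
set c := Rintegral PP _ _; set Y := (6 * _ + _); set Z := (_ * _ : R) => cV cYZ.
have V0 : 0 <= V := le_trans (normr_ge0 _) cV.
have G0 : 0 <= G by apply: Rintegral_ge0 => x _; exact: powR_ge0.
have Y0 : 0 <= Y.
  by rewrite addr_ge0// mulr_ge0// ?sqr_ge0// mulr_ge0// powR_ge0.
rewrite 2!(mulrC 2^-1) 2!powRrM -(powRM _ (powR_ge0 _ _) (powR_ge0 _ _)).
rewrite powR12_sqrt ?mulr_ge0 ?powR_ge0// -sqrtrM ?mulr_ge0//.
(* Writing |c| as the root of c^2, one factor c is bounded by V and the other by Y Z. *)
rewrite -[leLHS]normr_id -sqrtr_sqr ler_sqrt ?mulr_ge0 ?powR_ge0//.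
by rewrite -mulrA expr2 ler_pM.
Qed.

End Decay.
End CovarianceTruncation.

(** * Second moment of an average *)

Section FiniteSums.
Context d (T : measurableType d) (R : realType) (mu : {measure set T -> \bar R}).
Variables (I : Type) (F : I -> T -> R).
Hypothesis iF : forall i, mu.-integrable setT (EFin \o F i).

Lemma integrable_sum_EFin (s : seq I) :
  mu.-integrable setT (EFin \o (fun x => \sum_(i <- s) F i x)).
Proof.
have -> : EFin \o (fun x => \sum_(j <- s) F j x) =
    (fun x => \sum_(j <- s) (EFin \o F j) x)%E.
  by apply/funext => x; rewrite /= sumEFin.
exact: integrable_sum.
Qed.

Lemma Rintegral_sum (s : seq I) :
  \int[mu]_x (\sum_(i <- s) F i x) = \sum_(i <- s) \int[mu]_x F i x.
Proof.
elim: s => [|i s IHs].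
  rewrite big_nil; under eq_Rintegral do rewrite big_nil.
  by rewrite Rintegral_cst// mul0r.
rewrite big_cons -IHs -RintegralD//; last exact: integrable_sum_EFin.
by apply: eq_Rintegral => x _; rewrite big_cons.
Qed.

End FiniteSums.

Section SecondMoment.
Context {R : realType} {d : measure_display} {T : measurableType d}
  (mu : probability T R).
Variables (Y : nat -> T -> R) (c : nat -> R).
Hypotheses (iY : forall s t, mu.-integrable setT (EFin \o (fun w => Y s w * Y t w)))
  (covY : forall s k, `|\int[mu]_w (Y s w * Y (s + k)%N w)| <= c k).

Let c0 k : 0 <= c k.
Proof. exact: le_trans (normr_ge0 _) (covY 0 k). Qed.

(** Induction on j: the new row and the new column each meet the earlier times at the lags 1, ...,
    j, and the new corner has lag 0. *)
Let sum_cov j :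
  \sum_(0 <= s < j) \sum_(0 <= t < j) \int[mu]_w (Y s w * Y t w) <=
  \sum_(0 <= i < j) (c 0 + 2 * \sum_(1 <= k < i.+1) c k).
Proof.
elim: j => [|j IHj]; first by rewrite !big_geq.
rewrite [leRHS]big_nat_recr//= [leLHS]big_nat_recr//=.
under eq_bigr do rewrite big_nat_recr//=.
rewrite big_split/= -addrA lerD// [X in _ + X]big_nat_recr//=.
have sumc : \sum_(0 <= s < j) c (j - s)%N = \sum_(1 <= k < j.+1) c k.
  rewrite big_nat_rev/= add0n (big_addn 0 j.+1 1) subn1/=.
  apply: eq_big_nat => i /andP[_ ij]; congr c.
  by rewrite subKn// addn1.
have h1 : \sum_(0 <= s < j) \int[mu]_w (Y s w * Y j w) <= \sum_(1 <= k < j.+1) c k.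
  rewrite -sumc; apply: ler_sum_nat => s /andP[_ sj].
  by rewrite (le_trans (ler_norm _))// -{1}(subnKC (ltnW sj)).
have h2 : \sum_(0 <= t < j) \int[mu]_w (Y j w * Y t w) <= \sum_(1 <= k < j.+1) c k.
  apply: le_trans h1; apply: ler_sum => s _.
  rewrite le_eqVlt; apply/orP; left; apply/eqP.
  by apply: eq_Rintegral => w _; rewrite mulrC.
have h3 : \int[mu]_w (Y j w * Y j w) <= c 0.
  by rewrite (le_trans (ler_norm _))// -{2}(addn0 j).
lra.
Qed.

(** Extending every inner sum of [sum_cov] to all lags below n makes the n summands equal, which
    cancels one of the two factors 1/n. *)
Lemma second_moment_average n :
  ('E_mu[(fun w => `|n%:R^-1 * \sum_(0 <= s < n) Y s w| ^+ 2)%R] <=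
   (n%:R^-1 * (c 0 + 2 * \sum_(1 <= k < n) c k))%:E)%E.
Proof.
(* For n = 0 both sides vanish, because the inverse of 0 is 0. *)
rewrite unlock; have [->|n0] := posnP n.
  rewrite invr0 mul0r; under eq_integral do rewrite mul0r normr0 expr0n.
  by rewrite integral0.
pose Z w := n%:R^-1 ^+ 2 * \sum_(0 <= s < n) \sum_(0 <= t < n) (Y s w * Y t w).
have E w : `|n%:R^-1 * \sum_(0 <= s < n) Y s w| ^+ 2 = Z w.
  rewrite real_normK ?num_real// exprMn; congr (_ * _).
  by rewrite expr2 mulr_suml; apply: eq_bigr => s _; rewrite mulr_sumr.
have isum s : mu.-integrable setT (EFin \o (fun w => \sum_(0 <= t < n) (Y s w * Y t w))).
  exact: integrable_sum_EFin.
have isum2 : mu.-integrable setT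
    (EFin \o (fun w => \sum_(0 <= s < n) \sum_(0 <= t < n) (Y s w * Y t w))).
  exact: integrable_sum_EFin.
have iZ : mu.-integrable setT (EFin \o Z).
  exact: (@integrableZl _ _ _ _ _ measurableT (n%:R^-1 ^+ 2) _ isum2).
under eq_integral do rewrite E.
rewrite -[leLHS]fineK; last exact: integrable_fin_num.
rewrite lee_fin -[leLHS]/(Rintegral mu setT Z) /Z.
rewrite RintegralZl// Rintegral_sum//.
under eq_bigr do rewrite Rintegral_sum//.
have n0' : 0 < n%:R^-1 :> R by rewrite invr_gt0 ltr0n.
rewrite expr2 -mulrA ler_pM2l// ler_pdivrMl ?ltr0n//.
apply: (le_trans (sum_cov n)).
apply: (@le_trans _ _ (\sum_(0 <= i < n) (c 0 + 2 * \sum_(1 <= k < n) c k))).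
  apply: ler_sum_nat => i /andP[_ ilt]; rewrite lerD2l ler_pM2l//.
  by rewrite [leRHS](big_cat_nat _ ilt)//= lerDl sumr_ge0.
by rewrite sumr_const_nat subn0 [leRHS]mulr_natl.
Qed.

End SecondMoment.

(** * Comparison of the sum over lags with the integral of the rate *)

Section RateTail.
Context {R : realType} (rate : R -> R).
Hypothesis rateP : rate_function rate.

Lemma rate_gt0 u : 0 <= u -> 0 < rate u.
Proof. by move=> u0; have [/(_ u u0)/andP[]] := rateP. Qed.

Lemma rate_nonincreasing u v : 0 <= u -> u <= v -> rate v <= rate u.
Proof.
move=> u0; rewrite le_eqVlt => /predU1P[->//|uv].
by have [_ /(_ u v u0 uv)/ltW] := rateP.
Qed.

(** The k-th term is the integral of a constant over ]k-1, k], where the rate is at least its value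
    at k; hence the sum starts at t + 1. Only the step function has to be shown measurable. *)
Lemma rate_tail_ge_sum p t n : 1 < p ->
  ((\sum_(t.+1 <= k < n) rate k%:R `^ (2^-1 * (1 - p^-1)))%:E
    <= rate_tail rate p t)%E.
Proof.
move=> p1; set al : R := _ * _.
have al0 : 0 <= al.
  by rewrite mulr_ge0 ?invr_ge0// subr_ge0 invf_le1 ?(ltW p1)// (lt_trans ltr01 p1).
pose I k := `]k.-1%:R, k%:R]%classic : set R.
pose g (x : R) := \sum_(t.+1 <= k < n) rate k%:R `^ al * \1_(I k) x.
have mI k : measurable_fun (`[t%:R, +oo[%classic : set R) (\1_(I k) : R -> R).
  by apply: measurable_funTS; apply: measurable_indic; exact: measurable_itv.
have gE : (\int[lebesgue_measure]_(x in `[t%:R, +oo[) (g x)%:E =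
    (\sum_(t.+1 <= k < n) rate k%:R `^ al)%:E)%E.
  rewrite /g; under eq_integral do rewrite -sumEFin.
  rewrite ge0_integral_sum//; last 2 first.
  - move=> k; apply/measurable_EFinP/measurable_funM; last exact: mI.
    exact: measurable_cst.
  - by move=> k x _; rewrite lee_fin mulr_ge0// powR_ge0.
  rewrite -sumEFin; apply: eq_big_seq => k.
  rewrite mem_index_iota => /andP[tk kn].
  under eq_integral do rewrite EFinM.
  rewrite ge0_integralZl//; last 2 first.
  - by apply/measurable_EFinP; exact: mI.
  - by rewrite lee_fin powR_ge0.
  have mIk : measurable (I k) by exact: measurable_itv.
  have mD : measurable (`[t%:R, +oo[%classic : set R) by exact: measurable_itv.
  rewrite (integral_indic lebesgue_measure mD mIk) setIidl; last first.
    move=> x; rewrite /I/= !in_itv/= andbT => /andP[kx _].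
    rewrite (le_trans _ (ltW kx))// ler_nat -ltnS prednK//.
    exact: leq_trans tk.
  have k0 : (0 < k)%N by exact: leq_trans tk.
  rewrite -[RHS]mule1; congr (_ * _)%E.
  apply: eq_trans (lebesgue_measure_itv _) _.
  rewrite /= lte_fin ltr_nat prednK// leqnn.
  by rewrite -EFinB -natrB ?leq_pred// -subn1 subKn.
rewrite -gE; apply: ge0_le_integral_nonmeasurable.
  move=> x _; rewrite lee_fin sumr_ge0// => k _.
  by rewrite mulr_ge0// powR_ge0.
move=> x /=; rewrite in_itv/= andbT => tx; rewrite lee_fin.
have x0 : 0 <= x by apply: le_trans tx.
have ratex : 0 <= rate x `^ al by exact: powR_ge0.
(* The half-open intervals are disjoint, so g x is a single term of the sum or 0. *)
have [/hasP[k]|/hasPn no] := boolP (has (fun k => x \in I k) (index_iota t.+1 n)).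
  rewrite mem_index_iota => /andP[tk kn] xk.
  rewrite /g (bigD1_seq k) ?mem_index_iota ?tk ?iota_uniq//= big1_seq.
    rewrite addr0 indicE xk mulr1.
    move: xk => /set_mem; rewrite /I/= in_itv/= => /andP[_ xk].
    by apply: ge0_ler_powR; rewrite ?nnegrE ?(ltW (rate_gt0 _))//;
      exact: rate_nonincreasing.
  move=> j /andP[jk]; rewrite mem_index_iota => /andP[tj jn].
  rewrite indicE; have [xj|] := boolP (x \in I j); last by rewrite mulr0.
  exfalso; move/negP: jk; apply.
  move: xk xj => /set_mem + /set_mem; rewrite /I/= !in_itv/=.
  move=> /andP[kx xk] /andP[jx xj].
  have := lt_le_trans kx xj; have := lt_le_trans jx xk.
  rewrite !ltr_nat (prednK (leq_trans _ tk))// (prednK (leq_trans _ tj))//.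
  move=> h1 h2.
  by rewrite eqn_leq h1 h2.
rewrite /g big1_seq// => k /= kr; have := no k kr.
by rewrite indicE => /negbTE ->; rewrite mulr0.
Qed.

End RateTail.

(** * Moments of Lipschitz functions *)

Section PowerMeans.
Context {R : realType} {d : measure_display} {T : measurableType d}
  (mu : probability T R).
Local Open Scope ereal_scope.

(** Jensen's inequality for a power, obtained from Hölder's inequality against the constant 1, whose
    norm is 1 under a probability. *)
Lemma poweR_integral_le (g : T -> R) (s : R) : measurable_fun setT g ->
  (1 < s)%R ->
  (\int[mu]_x `|(g x)%:E|) `^ s <= \int[mu]_x (`|g x| `^ s)%:E.
Proof.
move=> mg s1; have s0 : (0 < s)%R := lt_trans ltr01 s1.
pose s' := ((1 - s^-1)^-1)%R.
have s'0 : (0 < s')%R by rewrite invr_gt0 subr_gt0 invf_lt1.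
have ss' : (s^-1 + s'^-1 = 1)%R by rewrite invrK addrC subrK.
have := hoelder mu mg (measurable_cst (1 : R)%R) s0 s'0 ss'.
rewrite Lnorm1; under eq_integral do rewrite /= mulr1.
have -> : 'N[mu]_s'%:E[EFin \o cst 1%R] = 1.
  rewrite -(poweR1r s'^-1) [LHS]Lnorm_cst1; congr poweR.
  exact: probability_setT.
rewrite mule1 => h.
have := @gt0_ler_poweR _ s (ltW s0) _ _ _ _ h.
rewrite !in_itv/= !leey !andbT integral_ge0// Lnorm_ge0 => /(_ isT isT).
by rewrite poweR_Lnorm ?gt_eqF.
Qed.

End PowerMeans.

Section LipschitzMoments.
Context {R : realType} {S : pointedMetricType R} (Pi : probability (borel S) R).
Variables (f : S -> R) (l : R).
Hypotheses (l0 : 0 < l) (fl : lipschitz_bound l f)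
  (f0 : (\int[Pi]_x (f x)%:E = 0)%E).
Local Open Scope ereal_scope.

Let mf : measurable_fun setT (f : borel S -> R).
Proof. exact: lipschitz_bound_measurable fl. Qed.

(** The extended integral is a difference with +oo - +oo = -oo, so a finite value already forces
    integrability. *)
Lemma integrable_mean0 : Pi.-integrable setT (EFin \o (f : borel S -> R)).
Proof.
apply/integrableP; split; first exact/measurable_EFinP.
by rewrite integral_fin_num_abs// f0.
Qed.

Lemma dist_integral_ge0 s y : 0 <= \int[Pi]_x (mdist (x : S) y `^ s)%:E.
Proof. by apply: integral_ge0 => x _; rewrite lee_fin powR_ge0. Qed.

(** As f has mean 0, f(y) is the mean of f(y) - f(x) over x. Jensen's inequality and |f(y) - f(x)|
    <= l d(x, y) then give the bound. *)
Lemma mean0_poweR_le (y : S) s : (1 < s)%R ->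
  ((`|f y| / l) `^ s)%:E <= \int[Pi]_x (mdist (x : S) y `^ s)%:E.
Proof.
move=> s1; have s0 : (0 < s)%R := lt_trans ltr01 s1.
have il : (0 < l^-1)%R by rewrite invr_gt0.
pose g (x : borel S) := (l^-1 * (f y - f x))%R.
have icst : Pi.-integrable setT (EFin \o (fun _ : borel S => f y)).
  exact: finite_measure_integrable_cst.
have ifyx : Pi.-integrable setT (EFin \o (fun x : borel S => (f y - f x)%R)).
  exact: (integrableB measurableT icst integrable_mean0).
have ig : Pi.-integrable setT (EFin \o g).
  exact: (@integrableZl _ _ _ _ _ measurableT l^-1 _ ifyx).
have mg : measurable_fun setT g by have /integrableP[/measurable_EFinP] := ig.
have gy : (\int[Pi]_x g x = l^-1 * f y)%R.
  rewrite RintegralZl// RintegralB//; last exact: integrable_mean0.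
  by rewrite probability_Rintegral_cst /Rintegral f0 subr0.
apply: (@le_trans _ _ (\int[Pi]_x (`|g x| `^ s)%:E)); last first.
  apply: ge0_le_integral_nonmeasurable => x _; rewrite lee_fin ?powR_ge0//.
  apply: ge0_ler_powR; rewrite ?nnegrE ?mdist_ge0 ?(ltW s0)//.
  by rewrite /g normrM (gtr0_norm il) mulrC ler_pdivrMr// mulrC fl.
apply: le_trans (poweR_integral_le Pi mg s1).
rewrite -poweR_EFin; apply: gt0_ler_poweR; rewrite ?(ltW s0)//.
- by rewrite in_itv/= leey andbT lee_fin divr_ge0// ltW.
- by rewrite in_itv/= leey andbT integral_ge0.
have -> : (`|f y| / l = `|\int[Pi]_x g x|)%R.
  by rewrite gy normrM (gtr0_norm il) mulrC.
rewrite EFin_normr_Rintegral//; apply: le_abse_integral => //.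
exact/measurable_EFinP.
Qed.

Lemma lipschitz_moment_le s : (1 < s)%R ->
  \int[Pi]_x ((`|f x| / l) `^ s)%:E <= dist_Lnorm Pi s `^ s.
Proof.
move=> s1; rewrite /dist_Lnorm -poweRrM mulVf ?gt_eqF ?(lt_trans _ s1)//.
rewrite poweRe1; last by apply: integral_ge0 => y _; exact: dist_integral_ge0.
apply: ge0_le_integral_nonmeasurable => x _; first by rewrite lee_fin powR_ge0.
exact: mean0_poweR_le.
Qed.

End LipschitzMoments.

Section LipschitzMomentsFinite.
Context {R : realType} {S : pointedMetricType R} (Pi : probability (borel S) R).
Variables (f : S -> R) (l s D : R).
Hypotheses (l0 : 0 < l) (fl : lipschitz_bound l f)
  (f0 : (\int[Pi]_x (f x)%:E = 0)%E) (s1 : 1 < s)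
  (dD : dist_Lnorm Pi s = D%:E).

Let D0 : 0 <= D.
Proof. by rewrite -lee_fin -dD poweR_ge0. Qed.

Let mfs : measurable_fun setT (fun x : borel S => (`|f x| / l) `^ s).
Proof.
apply: (measurableT_comp (measurable_powR s)); apply: measurable_funM => //.
apply: (measurableT_comp (@normr_measurable R setT)).
exact: lipschitz_bound_measurable fl.
Qed.

Let moment : (\int[Pi]_x ((`|f x| / l) `^ s)%:E <= (D `^ s)%:E)%E.
Proof. by have := lipschitz_moment_le l0 fl f0 s1; rewrite dD poweR_EFin. Qed.

Let powE x : `|f x| `^ s = l `^ s * (`|f x| / l) `^ s.
Proof.
rewrite -powRM ?divr_ge0 ?(ltW l0)//; congr (_ `^ _).
by rewrite mulrC divfK// gt_eqF.
Qed.

Let imoment : Pi.-integrable setT (EFin \o (fun x : borel S => (`|f x| / l) `^ s)).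
Proof.
apply/integrableP; split; first exact/measurable_EFinP.
under eq_integral do rewrite /= ger0_norm ?powR_ge0//.
exact: le_lt_trans moment (ltry _).
Qed.

Lemma lipschitz_moment_integrable :
  Pi.-integrable setT (EFin \o (fun x : borel S => `|f x| `^ s)).
Proof.
have -> : (fun x : borel S => `|f x| `^ s) =
    (fun x => l `^ s * (`|f x| / l) `^ s) by apply/funext => x; rewrite powE.
exact: (@integrableZl _ _ _ _ _ measurableT (l `^ s) _ imoment).
Qed.

Lemma lipschitz_Rmoment_le : \int[Pi]_x (`|f x| `^ s) <= (l * D) `^ s.
Proof.
under eq_Rintegral do rewrite powE.
rewrite RintegralZl// (powRM _ (ltW l0) D0) ler_wpM2l ?powR_ge0//.
rewrite -lee_fin fineK//; exact: integrable_fin_num.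
Qed.

End LipschitzMomentsFinite.

(** Jensen's inequality with exponent q/2 applied to f^2, in extended reals so that integrability of
    f^2 comes out as well. *)
Lemma Rintegral_sqr_le {R : realType} {d : measure_display} {T : measurableType d}
    (mu : probability T R) (f : T -> R) (q F : R) :
  measurable_fun setT f -> 2 < q -> 0 <= F ->
  mu.-integrable setT (EFin \o (fun x => `|f x| `^ q)) ->
  \int[mu]_x (`|f x| `^ q) <= F `^ q -> \int[mu]_x (f x ^+ 2) <= F ^+ 2.
Proof.
move=> mf q2 F0 iq le_q; have q0 : 0 < q by apply: lt_trans q2.
have s1 : 1 < q / 2 by rewrite ltr_pdivlMr// mul1r.
have mf2 : measurable_fun setT (fun x => f x ^+ 2) by exact: measurable_funX.
have := poweR_integral_le mu mf2 s1.
have absE x : (`|(f x ^+ 2)%:E| = (f x ^+ 2)%:E)%E.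
  by rewrite gee0_abs// lee_fin sqr_ge0.
under eq_integral do rewrite absE.
have powE x : `|f x ^+ 2| `^ (q / 2) = `|f x| `^ q.
  rewrite ger0_norm ?sqr_ge0// -(real_normK (num_real _)) -powR_mulrn// -powRrM.
  by congr (_ `^ _); rewrite mulrC divfK.
under [X in (_ <= X)%E]eq_integral do rewrite powE.
set I := (\int[mu]_x _)%E => h.
have I0 : (0 <= I)%E by apply: integral_ge0 => x _; rewrite lee_fin sqr_ge0.
have {}h : (I `^ (q / 2) <= (F `^ q)%:E)%E.
  apply: (le_trans h); rewrite -(fineK (integrable_fin_num measurableT iq)).
  by rewrite lee_fin.
have s'0 : 0 <= 2 / q by rewrite divr_ge0// ltW.
have := gt0_ler_poweR s'0 _ _ h.
rewrite !in_itv/= !leey poweR_ge0 lee_fin powR_ge0 => /(_ isT isT).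
have -> : ((I `^ (q / 2)) `^ (2 / q) = I)%E.
  rewrite -poweRrM (_ : q / 2 * (2 / q) = 1) ?poweRe1//.
  by field; rewrite gt_eqF.
rewrite -powRrM (_ : q * (2 / q) = 2); last first.
  by field; rewrite gt_eqF.
rewrite powR_mulrn// => IF.
by rewrite -lee_fin fineK// ge0_fin_numE// (le_lt_trans IF)// ltry.
Qed.

(** * Bounds on the mean square of the average *)

Section AverageBounds.
Context {R : realType} {S : pointedMetricType R} {d : measure_display}
  {Omega : measurableType d} (PP : probability Omega R).
Variables (P : nat -> R.-pker (borel S) ~> (borel S))
  (Pi : probability (borel S) R) (X : nat -> {RV PP >-> borel S})
  (M : borel S -> R) (rate : R -> R) (p : R).
Hypotheses (stat : stationary_markov_process P Pi X)
  (M1 : forall x, 1 <= M x) (rateP : rate_function rate)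
  (blM : forall (x : borel S) (t : nat),
    (bl_dist (P t x) Pi <= (M x * rate t%:R)%:E)%E)
  (p1 : 1 < p).
Variables (f : S -> R) (l : R).
Hypotheses (l0 : 0 <= l) (fl : lipschitz_bound l f)
  (f0 : (\int[Pi]_x (f x)%:E = 0)%E).
Let E2 (n : nat) : \bar R :=
  ('E_PP[(fun w => `| n%:R^-1 * \sum_(0 <= s < n) f (X s w) | ^+ 2)%R])%E.
Let q := 2 * p.
Let al := 2^-1 * (1 - p^-1).
Let be := 2^-1 * (1 - (2 * p)^-1).
Let m := \int[Pi]_x M x.

Let mf : measurable_fun setT (f : borel S -> R).
Proof. exact: lipschitz_bound_measurable fl. Qed.

Let q2 : 2 < q.
Proof. by rewrite /q ltr_pMr. Qed.

Let Rf0 : \int[Pi]_x f x = 0.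
Proof. by rewrite /Rintegral f0. Qed.

Let rate01 (t : nat) : 0 < rate t%:R <= 1.
Proof. by have [+ _ _] := rateP; exact. Qed.

Let alE : 2^-1 * (1 - 2 / q) = al.
Proof.
rewrite /al /q; congr (_ * (1 - _)); field.
by rewrite gt_eqF// (lt_trans ltr01).
Qed.

Let m_ge1 : Pi.-integrable setT (EFin \o M) -> 1 <= m.
Proof.
move=> iM; rewrite -[leLHS](probability_Rintegral_cst Pi).
by apply: le_Rintegral => //; exact: finite_measure_integrable_cst.
Qed.

(** Covers the degenerate cases, in which a vanishing factor can make the right-hand side 0. *)
Lemma average_le0 n :
  Pi.-integrable setT (EFin \o (fun x : borel S => `|f x| `^ 2)) ->
  \int[Pi]_x (f x ^+ 2) <= 0 -> (E2 n <= 0)%E.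
Proof.
move=> i2 V0.
have cov s k : `|\int[PP]_w (f (X s w) * f (X (s + k)%N w))| <= 0.
  exact: le_trans (covariance_le_variance stat fl (lexx 2) i2 s (s + k)) V0.
apply: le_trans (second_moment_average (integrable_pair stat fl (lexx 2) i2)
  cov n) _.
by rewrite big1 // mulr0 addr0 mulr0.
Qed.

Hypothesis iM : Pi.-integrable setT (EFin \o M).
Hypothesis iq : Pi.-integrable setT (EFin \o (fun x : borel S => `|f x| `^ q)).

(** Lags below t are bounded by the variance, at most F^2, and produce the summand t. From t on the
    decay bound applies; lag t gives the separate rate term, since [tau] only covers the lags from t
    + 1. *)
Lemma average_le_delayed (t n : nat) (F tau : R) : (t < n)%N -> 0 < F ->
  \int[Pi]_x (`|f x| `^ q) = F `^ q ->
  l <= F * rate t%:R `^ (- q^-1) ->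
  \sum_(t.+1 <= k < n) rate k%:R `^ al <= tau ->
  (E2 n <= (F ^+ 2 * (2 / n%:R) *
    (t%:R + 2 * Num.sqrt 6 * m `^ be * (rate t%:R `^ al + tau)))%:E)%E.
Proof.
move=> tn F0 FG lF sum_tau.
have V_le : \int[Pi]_x (f x ^+ 2) <= F ^+ 2.
  by apply: Rintegral_sqr_le iq _ => //; rewrite ?(ltW F0)// FG.
have V_ge0 : 0 <= \int[Pi]_x (f x ^+ 2).
  by apply: Rintegral_ge0 => x _; rewrite sqr_ge0.
pose B := 2 * Num.sqrt 6 * m `^ be.
have B0 : 0 <= B by rewrite !mulr_ge0// ?sqrtr_ge0// powR_ge0.
pose c (k : nat) := F ^+ 2 * (if (k < t)%N then 1 else B * rate k%:R `^ al).
have cov s k : `|\int[PP]_w (f (X s w) * f (X (s + k)%N w))| <= c k.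
  rewrite /c; case: ltnP => [_|tk].
    rewrite mulr1; apply: le_trans V_le.
    exact: (covariance_le_variance stat fl (ltW q2) iq).
  have rk := rate01 k; have /andP[rk0 _] := rk; have /andP[rt0 _] := rate01 t.
  have rkt : rate k%:R <= rate t%:R.
    by apply: (rate_nonincreasing rateP) => //; rewrite ler_nat.
  have lk : l <= F * rate k%:R `^ (- q^-1).
    apply: (le_trans lF); rewrite ler_pM2l// !powRN lef_pV2 ?posrE ?powR_gt0//.
    apply: ge0_ler_powR; rewrite ?nnegrE ?(ltW rk0) ?(ltW rt0)//.
    by rewrite invr_ge0 (le_trans _ (ltW q2)).
  have := covariance_decay_sqrt stat l0 fl (ltW q2) iq Rf0 iM
    (fun x => blM x k) rk s F0 lk (m_ge1 iM).
  rewrite alE FG -/m -/be => /le_trans; apply.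
  (* With A = F the decay constant becomes sqrt (V * 10 F^2) <= sqrt 24 F^2 = 2 sqrt 6 F^2. *)
  have -> : F `^ (2 - q) * F `^ q = F ^+ 2.
    by rewrite -powRD ?subrK ?(gt_eqF F0) ?implybT// powR_mulrn// ltW.
  have -> : F ^+ 2 * (B * rate k%:R `^ al) =
      F ^+ 2 * (2 * Num.sqrt 6) * (m `^ be * rate k%:R `^ al).
    by rewrite /B; ring.
  apply: ler_wpM2r; first by rewrite mulr_ge0// powR_ge0.
  rewrite -[leRHS]gtr0_norm ?mulr_gt0 ?exprn_gt0// ?sqrtr_gt0//.
  rewrite -sqrtr_sqr ler_sqrt ?sqr_ge0// !exprMn sqr_sqrtr//.
  have : 0 <= (F ^+ 2 - \int[Pi]_x (f x ^+ 2)) * F ^+ 2.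
    by rewrite mulr_ge0 ?subr_ge0 ?sqr_ge0.
  have : 0 <= F ^+ 2 * F ^+ 2 by rewrite mulr_ge0 ?sqr_ge0.
  by move: (Rintegral _ _ _) (F ^+ 2) => v u; nra.
have c_ge0 k : 0 <= c k := le_trans (normr_ge0 _) (cov 0 k).
apply: le_trans (second_moment_average (integrable_pair stat fl (ltW q2) iq)
  cov n) _.
rewrite lee_fin.
have nV : 0 < n%:R^-1 :> R by rewrite invr_gt0 ltr0n (leq_ltn_trans _ tn).
have -> : F ^+ 2 * (2 / n%:R) * (t%:R + 2 * Num.sqrt 6 * m `^ be *
    (rate t%:R `^ al + tau)) =
  n%:R^-1 * (2 * (F ^+ 2 * (t%:R + B * (rate t%:R `^ al + tau)))).
  by rewrite /B; ring.
rewrite ler_pM2l//.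
(* Lag 0 is counted twice to treat all lags alike; this is the overall factor 2 of part (1). *)
apply: (@le_trans _ _ (2 * \sum_(0 <= k < n) c k)).
  rewrite [leRHS](_ : _ = 2 * (c 0 + \sum_(1 <= k < n) c k)); last first.
    by congr (_ * _); rewrite big_ltn// (leq_ltn_trans _ tn).
  by have := c_ge0 0; lra.
rewrite ler_pM2l//.
rewrite (@big_cat_nat _ _ _ t)//=; last exact: ltnW.
have -> : \sum_(0 <= k < t) c k = F ^+ 2 * t%:R.
  rewrite (eq_big_nat _ _ (F2 := fun=> F ^+ 2)).
    by rewrite sumr_const_nat subn0 mulr_natr.
  by move=> k /andP[_ kt]; rewrite /c kt mulr1.
rewrite mulrDr lerD2l.
rewrite (eq_big_nat _ _ (F2 := fun k => F ^+ 2 * B * rate k%:R `^ al)); last first.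
  by move=> k /andP[tk _]; rewrite /c ltnNge tk/= mulrA.
rewrite -mulr_sumr -mulrA ler_wpM2l ?sqr_ge0// ler_wpM2l//.
by rewrite big_ltn// lerD2l.
Qed.

(** The maximum in A = l max(1, Dq) guarantees l <= A, so the decay bound holds at every lag. Lag 0
    uses D2^2 <= K; the other lags carry only the root of the variance and use D2 <= K. *)
Lemma average_le_lipschitz (n : nat) (D2 Dq K tau : R) : (0 < n)%N -> 0 < l ->
  0 <= D2 -> 0 <= Dq -> D2 <= K -> D2 ^+ 2 <= K ->
  \int[Pi]_x (f x ^+ 2) <= (l * D2) ^+ 2 ->
  \int[Pi]_x (`|f x| `^ q) <= (l * Dq) `^ q ->
  \sum_(1 <= k < n) rate k%:R `^ al <= tau ->
  (E2 n <= (n%:R^-1 * l ^+ 2 * K *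
    (1 + 2 * Num.sqrt (6 + 18 * Dq ^+ 2) * m `^ be * tau))%:E)%E.
Proof.
move=> n0 lgt0 D20 Dq0 D2K D22K V_le G_le sum_tau.
have K0 : 0 <= K := le_trans D20 D2K.
have V_ge0 : 0 <= \int[Pi]_x (f x ^+ 2).
  by apply: Rintegral_ge0 => x _; rewrite sqr_ge0.
have G_ge0 : 0 <= \int[Pi]_x (`|f x| `^ q).
  by apply: Rintegral_ge0 => x _; rewrite powR_ge0.
pose C := 6 + 18 * Dq ^+ 2.
have C0 : 0 < C by rewrite /C; have := sqr_ge0 Dq; lra.
pose A := l * Num.max 1 Dq.
have mx0 : 0 < Num.max 1 Dq by rewrite lt_max ltr01.
have A0 : 0 < A by rewrite mulr_gt0.
have lA : l <= A by rewrite ler_peMr ?(ltW lgt0)// le_max lexx.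
have AG : 6 * A ^+ 2 + 4 * (A `^ (2 - q) * \int[Pi]_x (`|f x| `^ q)) <= l ^+ 2 * C.
  have lDA : l * Dq <= A by rewrite ler_pM2l// le_max lexx orbT.
  have h : A `^ (2 - q) * \int[Pi]_x (`|f x| `^ q) <= (l * Dq) ^+ 2.
    (* Comparing the negative powers of [A] and [l * Dq] needs Dq > 0; for Dq = 0 the moment itself
       vanishes. *)
    have [Dqz|Dqn0] := eqVneq Dq 0; last first.
      have lD0 : 0 < l * Dq by rewrite mulr_gt0// lt0r Dqn0.
      apply: (le_trans (ler_wpM2l (powR_ge0 _ _) G_le)).
      apply: (@le_trans _ _ ((l * Dq) `^ (2 - q) * (l * Dq) `^ q)).
        rewrite ler_wpM2r ?powR_ge0// -opprB !powRN lef_pV2 ?posrE ?powR_gt0//.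
        by apply: ge0_ler_powR; rewrite ?nnegrE ?(ltW A0) ?(ltW lD0) ?subr_ge0 ?(ltW q2).
      by rewrite -powRD ?subrK ?(gt_eqF lD0) ?implybT// powR_mulrn// ltW.
    have -> : \int[Pi]_x (`|f x| `^ q) = 0.
      apply/eqP; rewrite eq_le G_ge0 andbT (le_trans G_le)//.
      by rewrite Dqz mulr0 powR0// gt_eqF// (lt_trans _ q2).
    by rewrite mulr0 sqr_ge0.
  have max_le : Num.max 1 Dq ^+ 2 <= 1 + Dq ^+ 2.
    case: (leP 1 Dq) => _; first by rewrite lerDr.
    by rewrite expr1n lerDl sqr_ge0.
  (* The sum is at most a (6 + 10 y); the 18 is what [c1] = 24 yields in C. *)
  have lin (x a y u : R) : x <= a * y -> 0 <= a * y -> a * u <= a * (1 + y) ->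
    6 * (a * u) + 4 * x <= a * (6 + 18 * y) by lra.
  rewrite exprMn; apply: lin.
  - by rewrite -exprMn.
  - by rewrite mulr_ge0 ?sqr_ge0.
  - by rewrite ler_wpM2l ?sqr_ge0.
pose c (k : nat) := if k is 0%N then l ^+ 2 * K
  else l ^+ 2 * K * (Num.sqrt C * m `^ be * rate k%:R `^ al).
have VK : \int[Pi]_x (f x ^+ 2) <= l ^+ 2 * K.
  by rewrite (le_trans V_le)// exprMn ler_wpM2l ?sqr_ge0.
have cov s k : `|\int[PP]_w (f (X s w) * f (X (s + k)%N w))| <= c k.
  case: k => [|k].
    rewrite /c; apply: le_trans VK.
    exact: (covariance_le_variance stat fl (ltW q2) iq).
  have rk := rate01 k.+1; have /andP[rk0 rk1] := rk.
  have lk : l <= A * rate k.+1%:R `^ (- q^-1).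
    rewrite (le_trans lA)// ler_peMr ?(ltW A0)//.
    rewrite -[leLHS](powRr0 (rate k.+1%:R)) ger_powR//.
    by rewrite oppr_le0 invr_ge0 (le_trans _ (ltW q2)).
  have := covariance_decay_sqrt stat l0 fl (ltW q2) iq Rf0 iM
    (fun x => blM x k.+1) rk s A0 lk (m_ge1 iM).
  rewrite alE -/m -/be => /le_trans; apply.
  rewrite /c -(mulrA (Num.sqrt C)) [leRHS]mulrA.
  apply: ler_wpM2r; first by rewrite mulr_ge0// powR_ge0.
  apply: (@le_trans _ _ (l ^+ 2 * D2 * Num.sqrt C)); last first.
    by rewrite ler_wpM2r ?sqrtr_ge0// ler_wpM2l ?sqr_ge0.
  have lD0 : 0 <= l ^+ 2 * D2 by rewrite mulr_ge0 ?sqr_ge0.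
  rewrite -[X in X * Num.sqrt C](ger0_norm lD0) -sqrtr_sqr -sqrtrM ?sqr_ge0//.
  rewrite ler_sqrt ?mulr_ge0 ?sqr_ge0 ?(ltW C0)//.
  rewrite (_ : (l ^+ 2 * D2) ^+ 2 * C = (l * D2) ^+ 2 * (l ^+ 2 * C)); last by ring.
  apply: ler_pM => //.
  by rewrite addr_ge0// mulr_ge0 ?sqr_ge0// mulr_ge0// powR_ge0.
apply: le_trans (second_moment_average (integrable_pair stat fl (ltW q2) iq)
  cov n) _.
rewrite lee_fin.
have nV : 0 < n%:R^-1 :> R by rewrite invr_gt0 ltr0n.
have -> : n%:R^-1 * l ^+ 2 * K *
    (1 + 2 * Num.sqrt (6 + 18 * Dq ^+ 2) * m `^ be * tau) =
  n%:R^-1 * (l ^+ 2 * K + 2 * (l ^+ 2 * K * (Num.sqrt C * m `^ be) * tau)).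
  by rewrite /C; ring.
rewrite ler_pM2l// lerD2l ler_pM2l//.
rewrite (eq_big_nat _ _
  (F2 := fun k => l ^+ 2 * K * (Num.sqrt C * m `^ be) * rate k%:R `^ al)); last first.
  by case=> // k _; rewrite /c -!mulrA.
rewrite -mulr_sumr ler_wpM2l// !mulr_ge0 ?sqr_ge0 ?sqrtr_ge0 ?powR_ge0//.
Qed.

End AverageBounds.

(** * Infinite and degenerate right-hand sides *)

Section ExtendedBounds.
Context {R : realType} {S : pointedMetricType R} {d : measure_display}
  {Omega : measurableType d} (PP : probability Omega R).
Variables (P : nat -> R.-pker (borel S) ~> (borel S))
  (Pi : probability (borel S) R) (X : nat -> {RV PP >-> borel S})
  (M : borel S -> R) (rate : R -> R) (p : R).
Hypotheses (stat : stationary_markov_process P Pi X)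
  (mM : measurable_fun setT M)
  (M1 : forall x, 1 <= M x) (rateP : rate_function rate)
  (blM : forall (x : borel S) (t : nat),
    (bl_dist (P t x) Pi <= (M x * rate t%:R)%:E)%E)
  (p1 : 1 < p).
Variables (f : S -> R).
Hypotheses (lf : (lip_norm f < +oo)%E) (f0 : (\int[Pi]_x (f x)%:E = 0)%E).
Local Open Scope ereal_scope.
Let E2 (n : nat) : \bar R :=
  'E_PP[(fun w => `| n%:R^-1 * \sum_(0 <= s < n) f (X s w) | ^+ 2)%R].
Let IM : \bar R := (\int[Pi]_x (M x)%:E) `^ (2^-1 * (1 - (2 * p)^-1)).
Let l : R := fine (lip_norm f).
Let q : R := (2 * p)%R.

Let lE : lip_norm f = l%:E.
Proof. by rewrite fineK// ge0_fin_numE// lip_norm_ge0. Qed.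

Let l0 : (0 <= l)%R.
Proof. by rewrite -lee_fin -lE lip_norm_ge0. Qed.

Let fl : lipschitz_bound l f := lip_normP lE.

Let mf : measurable_fun setT (f : borel S -> R).
Proof. exact: lipschitz_bound_measurable fl. Qed.

Let q2 : (2 < q)%R.
Proof. by rewrite /q ltr_pMr. Qed.

Let q0 : (0 < q)%R.
Proof. by apply: lt_trans q2. Qed.

Let be_gt0 : (0 < 2^-1 * (1 - (2 * p)^-1))%R.
Proof.
by rewrite mulr_gt0 ?invr_gt0// subr_gt0 invf_lt1// (lt_trans _ q2)// ltr1n.
Qed.

Let intM_ge1 : 1 <= \int[Pi]_x (M x)%:E.
Proof.
have -> : 1 = \int[Pi]_x (cst 1%:E) x.
  rewrite integral_cst// mul1e; apply/esym; exact: probability_setT.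
apply: ge0_le_integral => //; first exact/measurable_EFinP.
by move=> x _; rewrite lee_fin.
Qed.

Let IM_gt0 : 0 < IM.
Proof. by apply: poweR_gt0; exact: lt_le_trans intM_ge1. Qed.

Let IM_finite : IM != +oo ->
  Pi.-integrable setT (EFin \o M) /\
  IM = ((\int[Pi]_x M x) `^ (2^-1 * (1 - (2 * p)^-1)))%R%:E.
Proof.
move=> IMfin.
have Mfin : \int[Pi]_x (M x)%:E < +oo.
  rewrite ltey; apply: contra IMfin => /eqP Moo; apply/eqP.
  by apply: eqy_poweR => //.
have iM : Pi.-integrable setT (EFin \o M).
  apply/integrableP; split; first exact/measurable_EFinP.
  under eq_integral do rewrite gee0_abs ?lee_fin ?(le_trans ler01)//.
  exact: Mfin.
by split => //; rewrite /IM -poweR_EFin fineK//; exact: integrable_fin_num.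
Qed.

Let tail_ge0 t : 0 <= rate_tail rate p t.
Proof. by apply: integral_ge0 => x _; rewrite lee_fin powR_ge0. Qed.

Let rate_powR_gt0 (t : nat) a : (0 < rate t%:R `^ a)%R.
Proof. by rewrite powR_gt0// (rate_gt0 rateP). Qed.

Let mule_eqy (x y : \bar R) : 0 < x -> 0 < y -> x = +oo \/ y = +oo -> x * y = +oo.
Proof. by move=> x0 y0 [->|->]; [exact: gt0_mulye|exact: gt0_muley]. Qed.

Lemma average_delayed_bound (t n : nat) : (t < n)%N ->
  (rate t%:R)%:E <= SFR Pi q f `^ q ->
  E2 n <= 'N[Pi]_q%:E[EFin \o f] ^+ 2 * (2 / n%:R)%:E *
    (t%:R%:E + (2 * Num.sqrt 6)%:E * IM *
      ((rate t%:R `^ (2^-1 * (1 - p^-1)))%:E + rate_tail rate p t)).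
Proof.
move=> tn rate_le; set N := 'N[Pi]_q%:E[EFin \o f].
have n0 : (0 < n)%N := leq_ltn_trans (leq0n t) tn.
have N0 : 0 <= N by exact: Lnorm_ge0.
have c6 : 0 < (2 * Num.sqrt 6)%:E :> \bar R by rewrite lte_fin mulr_gt0// sqrtr_gt0.
set W := (rate t%:R `^ _)%:E + _.
have W0 : 0 < W.
  by apply: lt_le_trans (leeDl _ (tail_ge0 t)); rewrite lte_fin.
have cW : 0 < (2 * Num.sqrt 6)%:E * IM * W by rewrite !mule_gt0.
have tW : 0 < t%:R%:E + (2 * Num.sqrt 6)%:E * IM * W.
  by apply: lt_le_trans cW (leeDr _ _); rewrite lee_fin.
have n2 : 0 < (2 / n%:R)%:E :> \bar R by rewrite lte_fin divr_gt0// ltr0n.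
have [Noo|Nfin] := eqVneq N +oo.
  by rewrite Noo expe2 mulyy (gt0_mulye n2) (gt0_mulye tW) leey.
have NF : N = (fine N)%:E by rewrite fineK// ge0_fin_numE// ltey.
set F := fine N in NF.
have F0 : (0 <= F)%R by rewrite -lee_fin -NF.
have FqE : \int[Pi]_x (`|f x| `^ q)%:E = (F `^ q)%:E.
  have := poweR_Lnorm Pi (EFin \o f) (lt0r_neq0 q0).
  by rewrite -/N NF => <-.
have iq : Pi.-integrable setT (EFin \o (fun x : borel S => `|f x| `^ q)%R).
  apply/integrableP; split.
    apply/measurable_EFinP; apply: (measurableT_comp (measurable_powR q)).
    exact: (measurableT_comp (@normr_measurable R setT)).
  under eq_integral do rewrite /= ger0_norm ?powR_ge0//.
  by rewrite FqE ltry.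
have FG : (\int[Pi]_x (`|f x| `^ q) = F `^ q)%R by rewrite /Rintegral FqE.
(* Here the right-hand side is 0 even if [IM] or the tail is infinite, so this case comes before
   those. *)
have [Fz|Fn0] := eqVneq F 0%R.
  apply: (@le_trans _ _ 0); last first.
    by rewrite mule_ge0 ?(ltW tW)// mule_ge0 ?(ltW n2)// expe_ge0.
  apply: (average_le0 stat fl).
    by apply: (integrable_pow_le fl iq); rewrite ler0n (ltW q2).
  have := Rintegral_sqr_le mf q2 F0 iq; rewrite FG => /(_ (lexx _)).
  by rewrite Fz expr0n.
have Fgt0 : (0 < F)%R by rewrite lt0r Fn0.
have N2 : 0 < N ^+ 2 * (2 / n%:R)%:E.
  by rewrite mule_gt0// NF expe_gt0// lte_fin.
have [IMoo|IMfin] := eqVneq IM +oo.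
  rewrite [leRHS]mule_eqy ?leey//; right.
  rewrite IMoo (gt0_muley c6) (gt0_mulye W0) addey//.
have [tailoo|tailfin] := eqVneq (rate_tail rate p t) +oo.
  rewrite [leRHS]mule_eqy ?leey//; right.
  by rewrite /W tailoo addey// (gt0_muley (mule_gt0 c6 IM_gt0)) addey.
have tailE : rate_tail rate p t = (fine (rate_tail rate p t))%:E.
  by rewrite fineK// ge0_fin_numE// ltey.
have [iM ->] := IM_finite IMfin.
(* The hypothesis on [SFR] reads R(t) <= (F / l)^q and is solved for l; for l = 0, where [SFR] is
   +oo, the claim is immediate. *)
have lF : (l <= F * rate t%:R `^ (- q^-1))%R.
  have rt0 := rate_gt0 rateP (ler0n R t).
  have [lz|ln0] := eqVneq l 0%R; first by rewrite lz mulr_ge0// powR_ge0.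
  have lgt0 : (0 < l)%R by rewrite lt0r ln0.
  move: rate_le; rewrite /SFR lE eqe (negbTE ln0) f0.
  under eq_Lnorm do rewrite sube0.
  rewrite -/N NF inver (negbTE ln0) -EFinM poweR_EFin lee_fin => rate_le.
  rewrite powRN ler_pdivlMr ?powR_gt0// mulrC -ler_pdivlMr//.
  have Fl0 : (0 <= F / l)%R by rewrite divr_ge0.
  apply: (@le_trans _ _ (((F / l) `^ q) `^ q^-1)%R).
    apply: ge0_ler_powR => //; rewrite ?nnegrE ?invr_ge0 ?powR_ge0 ?(ltW q0)//.
    exact: ltW.
  by rewrite -powRrM mulfV ?gt_eqF// powRr1.
rewrite NF -EFin_expe /W tailE -!(EFinM, EFinD).
apply: (average_le_delayed stat M1 rateP blM p1 l0 fl f0 iM iq) => //.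
by rewrite -lee_fin -tailE; exact: rate_tail_ge_sum.
Qed.

Lemma average_lipschitz_bound (n : nat) :
  let K : \bar R := maxe (dist_Lnorm Pi 2) (dist_Lnorm Pi 2 ^+ 2) in
  let C : \bar R := (2^-1 * 24)%:E *
    ((2^-1)%:E + (3 / 2)%:E * dist_Lnorm Pi (2 * p) ^+ 2) in
  (1 <= n)%N ->
  E2 n <= (n%:R^-1)%:E * lip_norm f ^+ 2 * K *
    (1 + 2%:E * C `^ 2^-1 * IM * rate_tail rate p 0).
Proof.
move=> K C n0.
have d0 s : 0 <= dist_Lnorm Pi s :> \bar R by exact: poweR_ge0.
(* The single term k = 1 shows that the tail is positive, so an infinite factor beside it makes the
   product infinite. *)
have al_gt0 : 0 < rate_tail rate p 0.
  apply: lt_le_trans (rate_tail_ge_sum rateP 0 2 p1).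
  by rewrite big_nat1 lte_fin.
have C_gt0 : 0 < C.
  rewrite mule_gt0 ?lte_fin ?mulr_gt0// ?invr_gt0//.
  apply: lt_le_trans (leeDl _ _); first by rewrite lte_fin invr_gt0.
  by rewrite mule_ge0 ?expe_ge0// lee_fin divr_ge0.
have sC_gt0 : 0 < 2%:E * C `^ 2^-1 by rewrite mule_gt0 ?poweR_gt0.
have V0 : 0 < 2%:E * C `^ 2^-1 * IM * rate_tail rate p 0
  by rewrite mule_gt0// mule_gt0.
have W0 : 0 < 1 + 2%:E * C `^ 2^-1 * IM * rate_tail rate p 0.
  by apply: adde_gt0.
have K_ge0 : 0 <= K by rewrite le_max d0.
have nV0 : 0 < (n%:R^-1)%:E :> \bar R by rewrite lte_fin invr_gt0 ltr0n.
have rhs0 : 0 <= (n%:R^-1)%:E * lip_norm f ^+ 2 * K *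
    (1 + 2%:E * C `^ 2^-1 * IM * rate_tail rate p 0).
  rewrite mule_ge0 ?(ltW W0)// mule_ge0// mule_ge0 ?(ltW nV0)// expe_ge0//.
  exact: lip_norm_ge0.
have [lz|ln0] := eqVneq l 0%R.
  apply: le_trans rhs0.
  (* A Lipschitz bound of 0 makes f constant, and its mean is 0. *)
  have fz x : f x = 0%R.
    have fc y : f y = f x.
      have := fl x y; rewrite lz mul0r normr_le0 subr_eq0 => /eqP.
      exact.
    have := f0; under eq_integral do rewrite fc.
    by move=> /(congr1 fine); rewrite -[LHS]/(Rintegral Pi setT (fun=> f x))
      probability_Rintegral_cst.
  apply: (average_le0 stat fl).
    apply: (eq_integrable measurableT (cst 0)); last exact: integrable0.
    by move=> x _; rewrite /= fz normr0 powR0// pnatr_eq0.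
  under eq_Rintegral do rewrite fz expr0n.
  by rewrite probability_Rintegral_cst.
have lgt0 : (0 < l)%R by rewrite lt0r ln0.
have l2 : 0 < (n%:R^-1)%:E * lip_norm f ^+ 2.
  by rewrite mule_gt0// expe_gt0// lE lte_fin.
have [K_oo|Kfin] := eqVneq K +oo.
  by rewrite K_oo (gt0_muley l2) (gt0_mulye W0) leey.
have D2fin : dist_Lnorm Pi 2 != +oo :> \bar R.
  by apply: contra Kfin => /eqP D2oo; rewrite /K D2oo maxye.
have D2E : dist_Lnorm Pi 2 = (fine (dist_Lnorm Pi 2 : \bar R))%:E :> \bar R.
  by rewrite fineK// ge0_fin_numE// ltey.
set D2 := fine _ in D2E.
have D20 : (0 <= D2)%R by rewrite -lee_fin -D2E.
have i2 := lipschitz_moment_integrable lgt0 fl f0 (ltr1n R 2) D2E.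
have V_le : (\int[Pi]_x (f x ^+ 2) <= (l * D2) ^+ 2)%R.
  have := lipschitz_Rmoment_le lgt0 fl f0 (ltr1n R 2) D2E.
  rewrite powR_mulrn ?mulr_ge0//; apply: le_trans.
  rewrite le_eqVlt; apply/orP; left; apply/eqP; apply: eq_Rintegral => x _.
  by rewrite powR_mulrn// real_normK// num_real.
(* For D2 = 0 also K = 0, which annihilates any infinite factor; the second moment of f is then 0 as
   well. *)
have [D2z|D2n0] := eqVneq D2 0%R.
  apply: le_trans rhs0; apply: (average_le0 stat fl _ i2).
  by apply: (le_trans V_le); rewrite D2z mulr0 expr0n.
have KE : K = (Num.max D2 (D2 ^+ 2))%:E.
  by rewrite /K D2E -EFin_expe EFin_max.
have D2gt0 : (0 < D2)%R by rewrite lt0r D2n0.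
have Kgt0 : 0 < K by rewrite KE lte_fin lt_max D2gt0.
have lK : 0 < (n%:R^-1)%:E * lip_norm f ^+ 2 * K by rewrite mule_gt0.
have [V_oo|Vfin] := eqVneq (2%:E * C `^ 2^-1 * IM * rate_tail rate p 0) +oo.
  by rewrite V_oo addey// (gt0_muley lK) leey.
have tailfin : rate_tail rate p 0 != +oo.
  apply: contra Vfin => /eqP tailoo.
  by rewrite tailoo gt0_muley// mule_gt0.
have IMfin : IM != +oo.
  by apply: contra Vfin => /eqP IMoo; rewrite IMoo gt0_muley// gt0_mulye.
have sCfin : 2%:E * C `^ 2^-1 != +oo.
  by apply: contra Vfin => /eqP ->; rewrite gt0_mulye// gt0_mulye.
have Dqfin : dist_Lnorm Pi (2 * p) != +oo :> \bar R.
  apply: contra sCfin => /eqP Dqoo.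
  rewrite /C Dqoo expe2 mulyy gt0_muley ?lte_fin ?divr_gt0// addey//.
  rewrite gt0_muley ?lte_fin ?mulr_gt0 ?invr_gt0//.
  by rewrite poweRyr ?invr_neq0 ?pnatr_eq0// gt0_muley.
have DqE : dist_Lnorm Pi (2 * p) = (fine (dist_Lnorm Pi (2 * p) : \bar R))%:E :> \bar R.
  by rewrite fineK// ge0_fin_numE// ltey.
set Dq := fine _ in DqE.
have Dq0 : (0 <= Dq)%R by rewrite -lee_fin -DqE.
have q1 : (1 < q)%R by apply: lt_trans q2; rewrite ltr1n.
have iq := lipschitz_moment_integrable lgt0 fl f0 q1 DqE.
have Gle := lipschitz_Rmoment_le lgt0 fl f0 q1 DqE.
have tailE : rate_tail rate p 0 = (fine (rate_tail rate p 0))%:E.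
  by rewrite fineK// ge0_fin_numE// ltey.
have [iM IME] := IM_finite IMfin.
(* With [c1] = 24, C is 12 (1/2 + 3/2 Dq^2). *)
have CE : C `^ 2^-1 = (Num.sqrt (6 + 18 * Dq ^+ 2))%:E.
  rewrite /C DqE -EFin_expe -!(EFinM, EFinD) poweR_EFin powR12_sqrt.
    by congr (Num.sqrt _)%:E; field.
  by rewrite mulr_ge0// addr_ge0// mulr_ge0// sqr_ge0.
rewrite CE KE lE tailE IME -EFin_expe -!(EFinM, EFinD).
apply: (average_le_lipschitz stat M1 rateP blM p1 l0 fl f0 iM iq n0 lgt0 D20 Dq0) => //.
- by rewrite le_max lexx.
- by rewrite le_max lexx orbT.
- by rewrite -lee_fin -tailE; exact: rate_tail_ge_sum.
Qed.

End ExtendedBounds.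

Theorem corollary6 (R : realType) (S : pointedMetricType R)
    (d : measure_display) (Omega : measurableType d) (PP : probability Omega R)
    (P : nat -> R.-pker (borel S) ~> (borel S)) (Pi : probability (borel S) R)
    (X : nat -> {RV PP >-> borel S}) (M : borel S -> R) (rate : R -> R) (p : R) :
  stationary_markov_process P Pi X ->
  measurable_fun setT M ->
  (forall x, 1 <= M x) ->
  rate_function rate ->
  (forall (x : borel S) (t : nat),
     (bl_dist (P t x) Pi <= (M x * rate t%:R)%:E)%E) ->
  1 < p ->
  exists2 c1 : R, 0 < c1 <= 24 &
  forall f : S -> R,
    (lip_norm f < +oo)%E ->
    (\int[Pi]_x (f x)%:E = 0)%E ->
    let K : \bar R := maxe (dist_Lnorm Pi 2) (dist_Lnorm Pi 2 ^+ 2)%E in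
    let C : \bar R := ((2^-1 * c1)%:E *
              ((2^-1)%:E + (3 / 2)%:E * dist_Lnorm Pi (2 * p) ^+ 2))%E in
    let IM : \bar R := ((\int[Pi]_x (M x)%:E) `^ (2^-1 * (1 - (2 * p)^-1)))%E in
    let E2 (n : nat) : \bar R :=
      ('E_PP[(fun w => `| n%:R^-1 * \sum_(0 <= s < n) f (X s w) | ^+ 2)%R])%E in
    (forall t n : nat, (t < n)%N ->
       ((rate t%:R)%:E <= SFR Pi (2 * p) f `^ (2 * p))%E ->
       (E2 n <= 'N[Pi]_((2 * p)%:E)[EFin \o f] ^+ 2 * (2 / n%:R)%:E *
                (t%:R%:E + (2 * Num.sqrt 6)%:E * IM *
                   ((rate t%:R `^ (2^-1 * (1 - p^-1)))%:E
                    + rate_tail rate p t)))%E)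
    /\
    (forall n : nat, (1 <= n)%N ->
       (E2 n <= (n%:R^-1)%:E * lip_norm f ^+ 2 * K *
                (1 + 2%:E * C `^ 2^-1 * IM * rate_tail rate p 0))%E).
Proof.
(* The witness is tied to part (2): [c1] / 4 = 6 is the coefficient of A^2 in the decay bound. *)
move=> stat mM M1 rateP blM p1; exists 24; first by rewrite lexx andbT.
move=> f lf f0 K C IM E2; split=> [t n tn|n n1].
  exact: (average_delayed_bound stat mM M1 rateP blM p1 lf f0 tn).
exact: (average_lipschitz_bound stat mM M1 rateP blM p1 lf f0).
Qed.
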